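(* Let $\mathcal{A}\in\mathfrak{H}$ be an algorithm multiplying two integers $A,B$, each represented with $n$ base-$s$ digits. Let $\nu(8M)$ denote the total number of $8M$-maximal sub-problems (MSPs) generated by $\mathcal{A}$, and let $|\mathcal{T}|=\frac14\sum_i n_i^2$, where the sum ranges over the Type 1 $8M$-MSPs $P_i$ generated by $\mathcal{A}$ and $n_i$ is the input size of $P_i$ (so $4|\mathcal{T}|$ is the total number of elementary products computed by the Type 1 $8M$-MSPs). (i) In the sequential model with a cache of $M$ words in which a single I/O operation moves up to $B\le M$ words stored in consecutive memory locations, every execution schedule of $\mathcal{A}$ performs at least $$\max\{2n,\ |\mathcal{T}|/(4M),\ \nu(8M)\,M\}\,B^{-1}$$ I/O operations. (ii) In the parallel model with $P$ processors, each equipped with a local memory of size $M<n$, in which each I/O operation (message) moves up to $B_m\le M$ words, in every execution of $\mathcal{A}$ some processor sends or receives at least $$\max\{|\mathcal{T}|/(4M),\ \nu(8M)\,M\}\,(P B_m)^{-1}$$ messages.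
   Context: Integers are written in base $s\ge 2$ positional notation, $A=(A[n-1],\dots,A[0])_s$ with $A[0]$ least significant; each digit occupies one memory word; the size of an integer is its number of base-$s$ digits. Algorithms are modeled by computational DAGs (CDAGs): input vertices correspond to input digits, every other vertex to the result of a unit-time operation, and edges represent data dependencies (an edge $(u,v)$ iff the value of $u$ is an operand of the operation computing $v$). Standard class: an algorithm multiplying $n$-digit integers $A,B$ is standard if (i) it directly computes all $n^2$ elementary products $A[i]B[j]$, $0\le i,j\le n-1$; (ii) each digit $C[i]$ of $C=AB$, $0\le i\le 2n-2$, is computed by summing the elementary products $A[j]B[k]$ with $j+k=i$ through a summation tree using additions and subtractions only, plus any carry; (iii) the internal vertex sets of the summation trees of distinct $C[i]$ are disjoint. Toom-$k$ step ($k\ge2$ integer) on $n$-digit $A,B$: split each into $k$ blocks $A_0,\dots,A_{k-1}$ (resp. $B_i$) of $\lceil n/k\rceil$ consecutive digits, form $p(x)=\sum_i A_ix^i$, $q(x)=\sum_iB_ix^i$ (so $p(s^{\lceil n/k\rceil})=A$, $q(s^{\lceil n/k\rceil})=B$); evaluate $p,q$ at $2k-1$ distinct points $x_0,\dots,x_{2k-2}$ via the Vandermonde matrix; compute recursively the $2k-1$ products $p(x_i)q(x_i)$ (the sub-problems); recover the coefficients $r_i$ of $r=pq$ by multiplying by the inverse Vandermonde matrix; output $C=\sum_i r_i s^{i\lceil n/k\rceil}$. Class $\mathfrak{H}$: algorithms specified by an instruction function that, for each (sub)problem $P$ (a product of two integers), prescribes either a standard algorithm to compute $P$, or a value $k\ge2$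 (and evaluation points) such that $P$ is computed by a Toom-$k$ step, together with instruction functions for each of its $2k-1$ sub-problems; whenever Toom-$k$ is applied to a (sub)problem of input size $m$, each generated sub-problem has input size at most $2m/k<m$. Sub-problems of equal size, even at the same recursion level, may be treated differently. Maximal sub-problems: the whole problem is regarded as an (improper) sub-problem; the ancestors of a sub-problem are the sub-problems in the chain of recursive calls that generated it. For $n'\in\mathbb{N}^+$: if $n<n'$, $\mathcal{A}$ generates no $n'$-MSP. Otherwise, a sub-problem $P_i$ of input size $n_i\ge n'$ all of whose ancestors are computed by Toom-Cook steps is a Type 1 $n'$-MSP if it is computed by a standard algorithm, and a Type 2 $n'$-MSP if it is computed by a Toom-$k$ step all of whose generated sub-problems have input size strictly smaller than $n'$. Sequential model: cache (fast memory) of $M$ words and unbounded slow memory; an operation can be executed only if its operands are in cache; input initially in slow memory; read/write I/O operations move data between slow memory and cache; schedules may recompute intermediate values. Parallel model: $P$ processors with local (non-shared) memories exchanging point-to-point messages; recomputation allowed. *)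

(* Defs.v *)
From mathcomp Require Import all_boot all_order all_algebra.
Set Implicit Arguments.
Unset Strict Implicit.
Unset Printing Implicit Defensive.
Import Order.TTheory GRing.Theory Num.Theory.

(* A memory word holds one base-s digit, i.e. an element of 'Z_s.  Since 'Z_s
   is the ring of integers modulo s only for s >= 2, every statement below is
   meant under the hypothesis 1 < s.
   [op v f] is the word produced by the operation at [v] when every vertex u
   carries the word [f u]; [op_local] says that the operands of [v] are the
   tails of its incoming edges.  An operation without operands is a constant. *)
Record cdag (s : nat) := Cdag {
  vertex :> finType;
  edge : rel vertex;
  op : vertex -> (vertex -> 'Z_s) -> 'Z_s;
  edge_acyclic : forall u v, edge u v -> ~~ connect edge v u;
  op_local : forall v f g,
    (forall u, edge u v -> f u = g u) -> op v f = op v g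
}.

(* [f] is the assignment of words to vertices in one run of the algorithm: free
   on the input vertices [X], computed everywhere else.  "For all runs" is thus
   "for all values of the input digits". *)
Definition run_values s (G : cdag s) (X : {set G}) (f : G -> 'Z_s) : Prop :=
  forall v, v \notin X -> f v = op v f.

(* Integer represented by a sequence of vertices, least significant first. *)
Definition numval s (G : cdag s) (f : G -> 'Z_s) (w : seq G) : nat :=
  foldr (fun v acc => (f v : nat) + s * acc) 0 w.

(* The vertices of a (sub)problem of input size n inside a CDAG: the two
   operands, the 2n digits of the product, and the set [body] of all operations
   executed to obtain the product from the operands. *)
Record site (T : finType) (n : nat) := Site {
  inA : n.-tuple T;
  inB : n.-tuple T;
  outC : (n + n).-tuple T;
  body : {set T}
}.

Definition ins (T : finType) n (S : site T n) : {set T} :=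
  [set v in (inA S : seq T) ++ inB S].

Record site_ok (T : finType) n (S : site T n) : Prop := SiteOk {
  site_in_uniq : uniq ((inA S : seq T) ++ inB S);
  site_out_uniq : uniq (outC S);
  site_disjoint : [disjoint ins S & body S];
  site_out_body : {subset outC S <= body S}
}.

Definition multiplies s (G : cdag s) (X : {set G}) n (S : site G n) : Prop :=
  forall f, run_values X f ->
    numval f (outC S) = numval f (inA S) * numval f (inB S).

(* The boolean of an internal vertex selects subtraction. *)
Inductive sumtree (T : Type) : Type :=
| SLeaf of T
| SNode of T & bool & sumtree T & sumtree T.

Definition sroot (T : Type) (t : sumtree T) : T :=
  match t with SLeaf v => v | SNode v _ _ _ => v end.

Fixpoint sleaves (T : Type) (t : sumtree T) : seq T :=
  match t with SLeaf v => [:: v] | SNode _ _ l r => sleaves l ++ sleaves r end.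

Fixpoint sinner (T : Type) (t : sumtree T) : seq T :=
  match t with
  | SLeaf _ => [::]
  | SNode v _ l r => v :: sinner l ++ sinner r
  end.

Fixpoint sumtree_ok s (G : cdag s) (t : sumtree G) : Prop :=
  match t with
  | SLeaf _ => True
  | SNode v minus l r =>
      [/\ forall u, edge u v = (u == sroot l) || (u == sroot r),
          forall f : G -> 'Z_s,
            op v f = (if minus then f (sroot l) - f (sroot r)
                      else f (sroot l) + f (sroot r))%R,
          sumtree_ok l & sumtree_ok r]
  end.

(* What a vertex of a standard algorithm is used for: the elementary product
   A[i]B[j], an internal vertex of the summation tree of C[c], or part of the
   carry into position c.  As a vertex has one role only, the internal vertex
   sets of different summation trees are disjoint. *)
Inductive role : Type :=
| Product of nat & nat
| Sum of nat
| Carry of nat.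

Definition position (r : role) : nat :=
  match r with Product i j => i + j | Sum c => c | Carry c => c end.

(* Words are digits, so the word of the vertex A[i]B[j] and those of the
   summation trees are taken modulo s; what exceeds one digit (the high-order
   digit of A[i]B[j], the overflows and borrows of the sums) is part of the
   carry into the next positions.  The carry into position c is computed, by
   arbitrary operations, from the positions smaller than c only.  The leaves of
   the tree of C[c] are all the A[i]B[j] with i + j = c, and possibly carries
   into c; in the top position c = 2n - 1 there are only carries. *)
Record standard_step s (G : cdag s) n (S : site G n)
    (mul : 'I_n -> 'I_n -> G) (tree : 'I_(n + n) -> sumtree G)
    (rl : G -> role) : Prop := StandardStep {
  std_mul_body : forall i j, mul i j \in body S;
  std_mul_role : forall i j, rl (mul i j) = Product i j;
  std_mul_edge : forall i j u,
    edge u (mul i j) = (u == tnth (inA S) i) || (u == tnth (inB S) j);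
  std_mul_op : forall i j (f : G -> 'Z_s),
    op (mul i j) f = (f (tnth (inA S) i) * f (tnth (inB S) j))%R;
  std_mul_all : forall v i j, v \in body S -> rl v = Product i j ->
    exists i' j', v = mul i' j';
  std_tree_ok : forall c, sumtree_ok (tree c);
  std_tree_root : forall c, sroot (tree c) = tnth (outC S) c;
  std_tree_inner_uniq : forall c, uniq (sinner (tree c));
  std_tree_inner : forall (c : 'I_(n + n)) v,
    v \in sinner (tree c) <-> v \in body S /\ rl v = Sum c;
  std_tree_sum : forall v c, v \in body S -> rl v = Sum c -> c < n + n;
  std_tree_leaves_uniq : forall c, uniq (sleaves (tree c));
  std_tree_products : forall (c : 'I_(n + n)) (i j : 'I_n),
    i + j = c -> mul i j \in sleaves (tree c);
  std_tree_leaves : forall (c : 'I_(n + n)) u, u \in sleaves (tree c) ->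
    (exists i j : 'I_n, i + j = c /\ u = mul i j) \/
    (u \in body S /\ rl u = Carry c);
  std_carry : forall u v c, v \in body S -> rl v = Carry c -> edge u v ->
    [\/ u \in take c (inA S), u \in take c (inB S)
      | u \in body S /\ (position (rl u) < c \/ rl u = Carry c)]
}.

Definition standard s (G : cdag s) n (S : site G n) : Prop :=
  exists mul tree rl, @standard_step s G n S mul tree rl.

Definition block_len (n k : nat) : nat := (n + k.-1) %/ k.

Definition blockval s (G : cdag s) (f : G -> 'Z_s) n k (A : n.-tuple G)
    (j : nat) : nat :=
  numval f (take (block_len n k) (drop (j * block_len n k) A)).

Definition block_poly s (G : cdag s) (f : G -> 'Z_s) n k (A : n.-tuple G)
    : {poly int} :=
  \poly_(j < k) ((blockval f k A j)%:Z)%R.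

Notation npoints k := (k.*2.-1).

(* r_0, ..., r_{2k-2}, obtained from the values p(x_l)q(x_l).  The library's
   Vandermonde matrix has entry x_l ^ i in row i and column l, hence the
   product on the right. *)
Definition coefficients k (x : 'I_(npoints k) -> int) (p q : {poly int})
    : 'rV[rat]_(npoints k) :=
  (\row_l ((p.[x l] * q.[x l])%:~R : rat)
     *m invmx (Vandermonde (npoints k) (\row_l ((x l)%:~R : rat))))%R.

(* The vertices of a step, other than its operands: evaluation of p, evaluation
   of q, the sub-problems, interpolation, and final recomposition. *)
Inductive stage (k : nat) : Type :=
| EvalA
| EvalB
| SubProblem of 'I_(npoints k)
| Interp
| Compose.
Arguments EvalA {k}.
Arguments EvalB {k}.
Arguments SubProblem {k} _.
Arguments Interp {k}.
Arguments Compose {k}.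

(* The sub-problem for x_l multiplies the absolute values |p(x_l)| and
   |q(x_l)|; the signs, if needed, are separate words computed during the
   evaluation and used by the interpolation. *)
Definition sign_vertex s (G : cdag s) (X : {set G}) n k
    (x : 'I_(npoints k) -> int) (A : n.-tuple G) (u : G) : Prop :=
  exists l, forall f, run_values X f ->
    f u = (((block_poly f k A).[x l] < 0)%R : nat)%:R%R.

(* The evaluation, the interpolation and the recomposition may be carried out
   by any operations on words.  An operand word of a sub-problem may be a word
   of A (resp. B) itself, as for x_l = 0, and likewise a word of r_i may be an
   output word of a sub-problem and a word of C may be a word of some r_i. *)
Record toom_step s (G : cdag s) (X : {set G}) n (S : site G n)
    k (x : 'I_(npoints k) -> int) (m : 'I_(npoints k) -> nat)
    (D : forall l, site G (m l))
    (stg : G -> stage k) (coef : 'I_(npoints k) -> seq G) : Prop := ToomStep {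
  toom_sub_body : forall l v,
    v \in body (D l) <-> v \in body S /\ stg v = SubProblem l;
  toom_evalA_edge : forall u v, v \in body S -> stg v = EvalA -> edge u v ->
    u \in inA S \/ (u \in body S /\ stg u = EvalA);
  toom_evalB_edge : forall u v, v \in body S -> stg v = EvalB -> edge u v ->
    u \in inB S \/ (u \in body S /\ stg u = EvalB);
  toom_sub_inA : forall l u, u \in inA (D l) ->
    u \in inA S \/ (u \in body S /\ stg u = EvalA);
  toom_sub_inB : forall l u, u \in inB (D l) ->
    u \in inB S \/ (u \in body S /\ stg u = EvalB);
  toom_evalA : forall l f, run_values X f ->
    numval f (inA (D l)) = `|(block_poly f k (inA S)).[x l]%R|%N;
  toom_evalB : forall l f, run_values X f ->
    numval f (inB (D l)) = `|(block_poly f k (inB S)).[x l]%R|%N;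
  toom_interp_edge : forall u v, v \in body S -> stg v = Interp -> edge u v ->
    (exists l, u \in outC (D l)) \/
    u \in body S /\
      [\/ stg u = Interp,
          stg u = EvalA /\ sign_vertex X x (inA S) u
        | stg u = EvalB /\ sign_vertex X x (inB S) u];
  toom_coef : forall i u, u \in coef i ->
    (exists l, u \in outC (D l)) \/ (u \in body S /\ stg u = Interp);
  toom_interp : forall i f, run_values X f ->
    ((numval f (coef i))%:R : rat)%R =
      coefficients x (block_poly f k (inA S)) (block_poly f k (inB S)) 0%R i;
  toom_compose_edge : forall u v, v \in body S -> stg v = Compose ->
    edge u v ->
    (exists i, u \in coef i) \/ (u \in body S /\ stg u = Compose);
  toom_out : forall u, u \in outC S ->
    (exists i, u \in coef i) \/ (u \in body S /\ stg u = Compose);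
  toom_compose : forall f, run_values X f ->
    numval f (outC S) =
      \sum_i numval f (coef i) * s ^ (i * block_len n k)
}.

(* Instruction functions for a problem of input size n.  The evaluation points
   are integers: for a rational non-integer x, the value p(x) would not be an
   integer for all A. *)
Inductive instr : nat -> Type :=
| Standard n : instr n
| Toom n k (x : 'I_(npoints k) -> int) (m : 'I_(npoints k) -> nat)
    (sub : forall l, instr (m l)) : instr n.

(* Sub-problem sizes are at most 2n/k and smaller than n. *)
Fixpoint admissible n (t : instr n) : Prop :=
  match t with
  | Standard _ => True
  | Toom n k x m sub =>
      [/\ 2 <= k, injective x,
          forall l, k * m l <= 2 * n /\ m l < n
        & forall l, admissible (sub l)]
  end.

Fixpoint implements s (G : cdag s) (X : {set G}) n (t : instr n)
    : site G n -> Prop :=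
  match t in instr n return site G n -> Prop with
  | Standard n => fun S => [/\ site_ok S, multiplies X S & standard S]
  | Toom n k x m sub => fun S =>
      [/\ site_ok S, multiplies X S
        & exists (D : forall l, site G (m l)) stg coef,
            toom_step X S x D stg coef /\
            forall l, implements X (sub l) (D l)]
  end.

Record hybrid (s n : nat) := Hybrid {
  prog : cdag s;
  plan : instr n;
  top : site prog n;
  plan_admissible : admissible plan;
  top_all : ins top :|: body top = [set: prog];
  top_inputs : forall u v, v \in ins top -> ~~ edge u v;
  top_implements : implements (ins top) plan top
}.

(* All the sub-problems generated, the problem itself included.  Only Toom
   steps generate sub-problems, hence all ancestors of the elements of this
   list are computed by Toom steps. *)
Fixpoint subproblems n (t : instr n) : seq {m : nat & instr m} :=
  existT instr n t ::
  match t with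
  | Standard _ => [::]
  | Toom _ k _ m sub => flatten [seq subproblems (sub l) | l : 'I_(npoints k)]
  end.

Definition msp1 (n0 : nat) (p : {m : nat & instr m}) : bool :=
  (n0 <= tag p) &&
  match tagged p with Standard _ => true | Toom _ _ _ _ _ => false end.

Definition msp2 (n0 : nat) (p : {m : nat & instr m}) : bool :=
  (n0 <= tag p) &&
  match tagged p with
  | Standard _ => false
  | Toom _ _ _ m _ => [forall l, m l < n0]
  end.

Definition nu s n (H : hybrid s n) (n0 : nat) : nat :=
  count (fun p => msp1 n0 p || msp2 n0 p) (subproblems (plan H)).

(* |T|: a quarter of the number of elementary products computed by the MSPs of
   type 1. *)
Definition type1_products s n (H : hybrid s n) (n0 : nat) : rat :=
  ((\sum_(p <- subproblems (plan H) | msp1 n0 p) tag p ^ 2)%N%:R / 4)%R.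

(* Memory contents are described by the vertices whose words are stored.  Words
   may be dropped from a memory of bounded size at any step, and a vertex may
   be computed any number of times. *)

Fixpoint execution (State Action : Type)
    (step : Action -> State -> State -> Prop) (acts : seq Action) (st : State)
    : Prop :=
  match acts with
  | [::] => True
  | a :: acts' => exists2 st', step a st st' & execution step acts' st'
  end.

Definition operands s (G : cdag s) (v : G) : {set G} := [set u | edge u v].

Inductive seq_action (V : Type) : Type :=
| SCompute of V
| SRead of nat & nat     (* first address, number of words *)
| SWrite of nat & seq V. (* first address, words *)

Definition is_io (V : Type) (a : seq_action V) : bool :=
  match a with SCompute _ => false | _ => true end.

Record seq_state (V : finType) := SeqState {
  cache : {set V};
  slow : nat -> option V
}.

Definition store (V : Type) (mem : nat -> option V) (a : nat) (w : seq V)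
    : nat -> option V :=
  fun i => if a <= i < a + size w then onth w (i - a) else mem i.

Definition loaded (V : finType) (mem : nat -> option V) (a len : nat)
    : {set V} :=
  [set v | [exists i : 'I_len, mem (a + i) == Some v]].

Definition seq_step s n (H : hybrid s n) (M B : nat)
    (act : seq_action (prog H)) (st st' : seq_state (prog H)) : Prop :=
  #|cache st'| <= M /\
  match act with
  | SCompute v =>
      [/\ v \notin ins (top H), operands v \subset cache st,
          cache st' \subset v |: cache st & slow st' = slow st]
  | SRead a len =>
      [/\ len <= B, cache st' \subset cache st :|: loaded (slow st) a len
        & slow st' = slow st]
  | SWrite a w =>
      [/\ size w <= B, {subset w <= cache st}, cache st' \subset cache st
        & slow st' = store (slow st) a w]
  end.

(* A schedule performs every operation of the algorithm at least once.
   The slow memory initially holds the input digits only, at any addresses. *)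
Definition seq_schedule s n (H : hybrid s n) (M B : nat)
    (acts : seq (seq_action (prog H))) : Prop :=
  exists mem0 : nat -> option (prog H),
    [/\ forall a v, mem0 a = Some v -> v \in ins (top H),
        forall v, v \in ins (top H) -> exists a, mem0 a = Some v,
        execution (@seq_step s n H M B) acts (SeqState set0 mem0)
      & forall v, v \notin ins (top H) ->
          exists i, onth acts i = Some (SCompute v)].

Arguments seq_schedule {s n} H M B acts.

Definition io_count (V : Type) (acts : seq (seq_action V)) : nat :=
  count (@is_io V) acts.

Inductive par_action (V : finType) (P : nat) : Type :=
| PCompute of 'I_P & V
| PSend of 'I_P & 'I_P & {set V} (* source, destination, words *)
| PRecv of 'I_P & 'I_P & {set V}.

(* [net] holds the messages sent and not yet received, so that the interleaved
   executions below include those with simultaneous exchanges. *)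
Record par_state (V : finType) (P : nat) := ParState {
  loc : 'I_P -> {set V};
  net : seq ('I_P * 'I_P * {set V})
}.

Definition only_changes (V : finType) (P : nat) (p : 'I_P)
    (st st' : par_state V P) : Prop :=
  forall q, q != p -> loc st' q = loc st q.

Definition par_step s n (H : hybrid s n) (P M Bm : nat)
    (act : par_action (prog H) P) (st st' : par_state (prog H) P) : Prop :=
  (forall p, #|loc st' p| <= M) /\
  match act with
  | PCompute p v =>
      only_changes p st st' /\
      [/\ v \notin ins (top H), operands v \subset loc st p,
          loc st' p \subset v |: loc st p & net st' = net st]
  | PSend p q w =>
      only_changes p st st' /\
      [/\ p != q, #|w| <= Bm, w \subset loc st p, loc st' p \subset loc st p
        & net st' = (p, q, w) :: net st]
  | PRecv p q w =>
      only_changes q st st' /\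
      [/\ (p, q, w) \in net st, loc st' q \subset loc st q :|: w
        & net st' = rem (p, q, w) (net st)]
  end.

(* Every operation is performed at least once by some processor.
   The input digits are initially distributed in any way, possibly with
   replication, among the local memories. *)
Definition par_execution s n (H : hybrid s n) (P M Bm : nat)
    (acts : seq (par_action (prog H) P)) : Prop :=
  exists loc0 : 'I_P -> {set prog H},
    [/\ forall p, loc0 p \subset ins (top H) /\ #|loc0 p| <= M,
        forall v, v \in ins (top H) -> exists p, v \in loc0 p,
        execution (@par_step s n H P M Bm) acts (ParState loc0 [::])
      & forall v, v \notin ins (top H) ->
          exists i p, onth acts i = Some (PCompute p v)].

Arguments par_execution {s n} H P M Bm acts.

Definition messages (V : finType) (P : nat) (acts : seq (par_action V P))
    (p : 'I_P) : nat :=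
  count (fun a => match a with
                  | PCompute _ _ => false
                  | PSend q _ _ => q == p
                  | PRecv _ q _ => q == p
                  end) acts.

(* Main.v *)
(* Let q be the number of words that all processors together load or store; it
   suffices to show q >= nu M and 16 M q >= the sum of the n_i ^ 2 over the MSPs
   of type 1.  Cut the local trace of each processor into chunks of M such word
   transfers, the incomplete chunk coming first.  Everything computed in a chunk
   is a function of a set D of at most 2M words: the initial memory and the words
   loaded.  The words of D inside the MSPs are private to one MSP; those used to
   evaluate the operands depend on the digits of A only or of B only.

   If the higher digits of A vanish, every evaluation polynomial is constant, so
   both operands of an MSP of size n_i run independently through all numbers of
   ceil(n_i / 2) digits.  Let one operand be an unknown word w of h digits and
   the other s ^ j + s ^ (j + h): the product then shows the cyclic shift of w by
   j.  For a fixed value of the words of D on the side of w, of which there are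
   a, at least s ^ (h - a) words w remain.  Summing over the shifts j, Shearer's
   inequality shows that z outputs in a window of h positions require at least
   z (h - a) / h private words; by symmetry a may be taken to be the smaller of
   the two sides.  This bounds the number of outputs per chunk, hence nu M.

   For the MSPs of type 1, assign A[i]B[j] to a chunk in which it is computed and
   after which a vertex on its path to the root of the summation tree survives,
   or in which this root is computed.  Only O(M) positions i + j are active in a
   chunk, and a chunk knows at most a digits of one of the operands, so that at
   most 5/2 M products are assigned per word transferred. *)
Require Import Defs.
From Stdlib Require Import ZArith Psatz.
From mathcomp Require Import all_boot all_order all_algebra all_field.
From mathcomp Require Import zify.
Set Implicit Arguments.
Unset Strict Implicit.
Unset Printing Implicit Defensive.
Import Order.TTheory GRing.Theory Num.Theory.

(** * Shearer's inequality *)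

(** Hölder's inequality with equal exponents, cleared of roots. The arithmetic-geometric mean
    inequality bounds each [y c] by the [#|A|]-th root of [Q * \prod X j] times the mean of the
    quotients [x j c / X j], and these means sum to at most 1. *)
Lemma holder_card (C J : finType) (A : {set J}) (Q : nat) (y : C -> nat)
    (x : J -> C -> nat) (X : J -> nat) :
  0 < #|A| ->
  (forall j, j \in A -> \sum_c x j c <= X j) ->
  (forall c, y c ^ #|A| <= Q * \prod_(j in A) x j c) ->
  (\sum_c y c) ^ #|A| <= Q * \prod_(j in A) X j.
Proof.
move=> k0 leX ley.
(* A vanishing [X j] cannot be divided by, but it forces every [y c] to be 0. *)
have [X0|] := boolP [exists j in A, X j == 0].
  have [j jA /eqP Xj] := exists_inP X0.
  rewrite big1 ?exp0n // => c _; apply/eqP.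
  have := ley c; rewrite (bigD1 j jA) /=.
  have /eqP -> : x j c == 0.
    by have := leX j jA; rewrite Xj leqn0 sum_nat_eq0 => /forallP /(_ c).
  by rewrite mul0n muln0 leqn0 expn_eq0 => /andP [].
move=> /exists_inPn Xn0.
set k := #|A| in k0 ley *; set N := Q * _.
pose r : algC := k.-root N%:R%R.
have r0 : (0 <= r)%R by rewrite rootC_ge0 // ler0n.
have rk : (r ^+ k = N%:R)%R by rewrite rootCK.
have Xpos j : j \in A -> ((0 : algC) < (X j)%:R)%R.
  by move=> /Xn0; rewrite ltr0n lt0n.
pose m c : algC := ((\sum_(j in A) (x j c)%:R / (X j)%:R) / k%:R)%R.
have E0 c j : j \in A -> ((0 : algC) <= (x j c)%:R / (X j)%:R)%R.
  by move=> jA; rewrite divr_ge0 ?ler0n.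
have m0 c : (0 <= m c)%R by rewrite divr_ge0 ?ler0n // sumr_ge0 // => j; exact: E0.
have lem c : ((y c)%:R <= r * m c)%R.
  rewrite -(@ler_pXn2r _ k) ?nnegrE ?ler0n ?(mulr_ge0 r0 (m0 c)) // exprMn rk.
  apply: (@le_trans _ _ (N%:R * \prod_(j in A) ((x j c)%:R / (X j)%:R))%R); last first.
    apply: ler_wpM2l; first exact: ler0n.
    have /leif_AGM[] := E0 c; exact.
  rewrite prodf_div -!natr_prod /N natrM mulrCA -natrX.
  rewrite mulfK; last by rewrite pnatr_eq0 -lt0n prodn_cond_gt0 // => j /Xn0; rewrite lt0n.
  by rewrite mulrC -natrM ler_nat.
rewrite -(ler_nat algC) natrX -rk ler_pXn2r ?nnegrE ?ler0n //.
rewrite natr_sum; apply: (le_trans (ler_sum _ (fun c _ => lem c))).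
rewrite -mulr_sumr -{2}(mulr1 r); apply: ler_wpM2l => //.
rewrite -mulr_suml exchange_big /= ler_pdivrMr ?ltr0n // mul1r.
rewrite /k -sumr_const; apply: ler_sum => j jA.
by rewrite -mulr_suml ler_pdivrMr ?Xpos // mul1r -natr_sum ler_nat leX.
Qed.

(** Values outside [A] become [None], so that the projections to different sets share one type. *)
Definition restr (I T : finType) (A : {set I}) (f : {ffun I -> T}) :
  {ffun I -> option T} := [ffun i => if i \in A then Some (f i) else None].

(** Induction on the set [C] of coordinates in which members of [W] may differ. When [W] is sliced
    by the value at some [i] in [C], the projections that read [i] split into disjoint slices, the
    others only shrink, and [holder_card] adds up the slices. *)
Lemma shearer (I J T : finType) (A : J -> {set I}) (k : nat) (C : {set I})
    (W : {set {ffun I -> T}}) :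
  0 < k -> (forall i, i \in C -> #|[set j | i \in A j]| = k) ->
  (forall f g i, f \in W -> g \in W -> i \notin C -> f i = g i) ->
  #|W| ^ k <= \prod_j #|restr (A j) @: W|.
Proof.
move=> k0; have [m] := ubnP #|C|; elim: m C W => // m IH C W ltC covC eqW.
have [->|/set0Pn [f0 f0W]] := eqVneq W set0; first by rewrite cards0 exp0n.
have posP j : 0 < #|restr (A j) @: W|.
  by rewrite card_gt0; apply/set0Pn; exists (restr (A j) f0); apply: imset_f.
have [C0|/set0Pn [i iC]] := eqVneq C set0.
  have -> : W = [set f0].
    apply/setP => f; rewrite inE; apply/idP/eqP => [fW|->//].
    by apply/ffunP => i; apply: eqW; rewrite ?C0 ?inE.
  by rewrite cards1 exp1n prodn_gt0 // => j; rewrite card_gt0 imset_eq0 -card_gt0 cards1.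
pose W' c := [set f in W | f i == c].
have cardW : #|W| = \sum_c #|W' c|.
  rewrite -sum1_card (partition_big (fun f : {ffun I -> T} => f i) predT) //=.
  by apply: eq_bigr => c _; rewrite -sum1_card; apply: eq_bigl => f; rewrite inE.
pose B := [set j | i \in A j].
(* The projections that do not read [i] form the constant factor [Q] of [holder_card]. *)
rewrite (bigID (mem B)) /= mulnC cardW -(covC i iC).
apply: (@holder_card _ _ B _ _ (fun j c => #|restr (A j) @: W' c|)).
- by rewrite (covC i iC).
- move=> j; rewrite inE => ij.
  rewrite -[X in _ <= X]sum1_card.
  rewrite (partition_big (fun f : {ffun I -> option T} => odflt (f0 i) (f i)) predT) //=.
  apply: leq_sum => c _; rewrite -sum1_card.
  rewrite [X in _ <= X](eq_bigl (fun g => g \in [set g in restr (A j) @: W | odflt (f0 i) (g i) == c]));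
    last by move=> g; rewrite inE.
  rewrite !sum1_card; apply/subset_leq_card/subsetP => g /imsetP [f].
  rewrite !inE => /andP [fW /eqP fc] ->.
  by rewrite imset_f //= /restr !ffunE ij fc /=.
- move=> c; rewrite (covC i iC).
  have ltCi : #|C :\ i| < m by move: ltC; rewrite (cardsD1 i) iC.
  have covCi i' : i' \in C :\ i -> #|[set j | i' \in A j]| = k.
      by rewrite !inE => /andP [_ ?]; exact: covC.
  have eqWi f g i' : f \in W' c -> g \in W' c -> i' \notin C :\ i -> f i' = g i'.
      rewrite !inE => /andP [fW /eqP fc] /andP [gW /eqP gc].
      by have [->|_ /=] := eqVneq i' i; [rewrite fc gc|apply: eqW].
  apply: leq_trans (IH _ _ ltCi covCi eqWi) _.
  rewrite (bigID (mem B)) /= mulnC leq_mul2r; apply/orP; right.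
  apply: leq_prod => j _; apply/subset_leq_card/imsetS.
  by apply/subsetP => f; rewrite inE => /andP [].
Qed.

Lemma large_fiber (X U : finType) (f : X -> U) (x0 : X) :
  exists u, #|X| <= #|[set x | f x == u]| * #|f @: [set: X]|.
Proof.
set I := f @: _.
have fx0 : f x0 \in I by apply: imset_f.
pose u := [arg max_(i > f x0 in I) #|[set x | f x == i]|].
exists u; rewrite /u; case: arg_maxnP => //= {}u _ max_u.
rewrite -sum1_card (partition_big f (mem I)) /=; last by move=> x _; apply: imset_f.
rewrite mulnC -sum_nat_const; apply: leq_sum => i iI.
by rewrite sum1_card -cardsE max_u.
Qed.

(* Each coordinate of [w] is read by exactly [#|Z|] of the cyclic shifts, so
   Shearer's inequality applies to a large fibre of [fa]. *)
Lemma cyclic_info (h a d : nat) (T U V : finType) (Z : {set 'I_h.+1})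
    (fa : {ffun 'I_h.+1 -> T} -> U) (fd : 'I_h.+1 -> {ffun 'I_h.+1 -> T} -> V) :
  1 < #|T| -> #|fa @: setT| <= #|T| ^ a ->
  (forall j, #|fd j @: setT| <= #|T| ^ d) ->
  (forall j w w', fa w = fa w' -> fd j w = fd j w' ->
     forall z, z \in Z -> w (z - j)%R = w' (z - j)%R) ->
  #|Z| * (h.+1 - a) <= h.+1 * d.
Proof.
move=> T1 le_a le_d fdP.
have T0 : 0 < #|T| by apply: ltnW.
have [->|/set0Pn [z0 z0Z]] := eqVneq Z set0; first by rewrite cards0.
have Z0 : 0 < #|Z| by rewrite card_gt0; apply/set0Pn; exists z0.
have [/eqP -> |ha] := boolP (h.+1 - a == 0); first by rewrite muln0.
have {}ha : a <= h.+1 by lia.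
have /card_gt0P [t0 _] := T0.
have [u leu] := large_fiber fa [ffun=> t0].
set W := [set x | _] in leu.
have leW : #|T| ^ (h.+1 - a) <= #|W|.
  rewrite -(@leq_pmul2r (#|T| ^ a)) ?expn_gt0 ?T0 // -expnD subnK //.
  apply: leq_trans (leq_mul (leqnn _) le_a).
  by apply: leq_trans leu; rewrite card_ffun card_ord.
pose A (j : 'I_h.+1) := [set (z - j)%R | z in Z].
have covA i : i \in [set: 'I_h.+1] -> #|[set j | i \in A j]| = #|Z|.
  move=> _; rewrite -(card_imset (mem Z) (f := fun z : 'I_h.+1 => (z - i)%R)); last first.
    by move=> x y /addIr.
  apply: eq_card => j; rewrite inE; apply/imsetP/imsetP => -[z zZ e]; exists z => //.
    by rewrite e opprB addrC subrK.
  by rewrite e opprB addrC subrK.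
have eqW f g i : f \in W -> g \in W -> i \notin [set: 'I_h.+1] -> f i = g i.
  by move=> _ _; rewrite inE.
have := shearer Z0 covA eqW.
(* On the fibre [W] the value of [fd j] determines the projection to [A j]; [g] is this
   dependence. *)
have leP j : #|restr (A j) @: W| <= #|T| ^ d.
  apply: leq_trans (le_d j).
  pose g (v : V) := if [pick w in W | fd j w == v] is Some w then restr (A j) w
                    else restr (A j) [ffun=> t0].
  apply: leq_trans (leq_imset_card g (mem (fd j @: setT))).
  apply/subset_leq_card/subsetP => r.
  case/imsetP => w wW ->; apply/imsetP; exists (fd j w); first exact: imset_f.
  rewrite /g; case: pickP => [w' /andP [w'W /eqP e]|/(_ w)]; last by rewrite wW eqxx.
  have efa : fa w = fa w' by move: wW w'W; rewrite !inE => /eqP -> /eqP ->.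
  apply/ffunP => i; rewrite !ffunE; case: ifP => // /imsetP [z zZ ->].
  by rewrite (fdP j w w' efa (esym e)).
move=> /leq_trans /(_ (leq_prod (fun j _ => leP j))).
rewrite prod_nat_const card_ord => le1.
rewrite -(leq_exp2l _ _ T1) mulnC [h.+1 * d]mulnC !expnM.
by apply: leq_trans le1; rewrite leq_exp2r.
Qed.

(** * Runs of the algorithm *)

(** The number of ancestors grows strictly along edges and serves as the rank for induction over the
    graph. *)
Definition ancestors s (G : cdag s) (v : G) : {set G} :=
  [set u : G | connect (@edge s G) u v].

Lemma ancestors_edge s (G : cdag s) (u v : G) :
  edge u v -> #|ancestors u| < #|ancestors v|.
Proof.
move=> uv; apply: proper_card; apply/properP; split.
  by apply/subsetP => w; rewrite !inE => wu; apply: connect_trans wu (connect1 uv).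
by exists v; rewrite !inE ?connect0 //; exact: edge_acyclic.
Qed.

Lemma edge_ind s (G : cdag s) (P : G -> Prop) :
  (forall v, (forall u, edge u v -> P u) -> P v) -> forall v, P v.
Proof.
move=> IH v; have [m] := ubnP #|ancestors v|.
elim: m v => // m IHm v ltv; apply: IH => u uv; apply: IHm.
exact: leq_trans (ancestors_edge uv) (ltv : _ <= m).
Qed.

(** [m] is fuel. Running out of it yields [x v], which has no effect on the result once [m] is at
    least the number of ancestors of [v]. *)
Fixpoint evaln s (G : cdag s) (X : {set G}) (x : G -> 'Z_s) (m : nat) (v : G) : 'Z_s :=
  if m is m'.+1 then if v \in X then x v else op v (evaln X x m') else x v.

(** One unit more than [#|G|], so that after unfolding at a vertex the fuel still suffices for its
    operands. *)
Definition eval s (G : cdag s) (X : {set G}) (x : G -> 'Z_s) : G -> 'Z_s :=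
  evaln X x #|G|.+1.

Lemma evaln_stable s (G : cdag s) (X : {set G}) x (v : G) m1 m2 :
  #|ancestors v| <= m1 -> #|ancestors v| <= m2 -> evaln X x m1 v = evaln X x m2 v.
Proof.
have pos w : 0 < #|ancestors w : {set G}|.
  by apply/card_gt0P; exists w; rewrite inE connect0.
elim: m1 m2 v => [|m1 IH] [|m2] v; try by rewrite [_ <= 0]leqNgt pos.
move=> le1 le2 /=; case: ifP => // _; apply: op_local => u /ancestors_edge lt.
by apply: IH; rewrite -ltnS; apply: leq_trans lt _.
Qed.

Lemma eval_run s (G : cdag s) (X : {set G}) x : run_values X (eval X x).
Proof.
move=> v vX; rewrite {1}/eval /= (negbTE vX); apply: op_local => u _.
by apply: evaln_stable; rewrite ?(leqW (max_card _)) ?max_card.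
Qed.

Lemma eval_in s (G : cdag s) (X : {set G}) x v : v \in X -> eval X x v = x v.
Proof. by rewrite /eval /= => ->. Qed.

(** A notion of knowledge that is insensitive to recomputation: whatever the order of the
    operations, the words of [T] are functions of those of [D] ([supported_eq]). *)
Definition supported s (G : cdag s) (X D T : {set G}) : Prop :=
  forall v, v \in T -> v \in D \/ v \notin X /\ (forall u, edge u v -> u \in T).

Lemma supported_eq s (G : cdag s) (X D T : {set G}) f g :
  run_values X f -> run_values X g -> supported X D T ->
  {in D, f =1 g} -> {in T, f =1 g}.
Proof.
move=> rf rg supT eqD; elim/edge_ind => v IH /supT [/eqD //|[vX opT]].
by rewrite rf // rg //; apply: op_local => u uv; apply: IH => //; exact: opT.
Qed.

(** Words outside a set that is closed under taking operands cannot influence the words inside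
    it. *)
Lemma supportedI s (G : cdag s) (X D T K : {set G}) :
  supported X D T ->
  (forall u v, v \in K -> v \notin X -> edge u v -> u \in K) ->
  supported X (D :&: K) (T :&: K).
Proof.
move=> supT clK v; rewrite inE => /andP [/supT [vD|[vX opT]] vK]; [left|right].
  by rewrite inE vD.
by split=> // u uv; rewrite inE opT // (clK u v).
Qed.

(** * Positional notation: values and digits of words *)

Section Numval.

Variables (s : nat) (G : cdag s) (f : G -> 'Z_s).
Hypothesis s1 : 1 < s.

Lemma word_lt v : (f v : nat) < s.
Proof. by have := ltn_ord (f v); rewrite [in X in _ < X -> _]Zp_cast. Qed.

Lemma numval_cat u w : numval f (u ++ w) = numval f u + s ^ size u * numval f w.
Proof. by elim: u => [|v u IH] /=; rewrite ?mul1n // IH expnS mulnDr mulnA addnA. Qed.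

Lemma numval_digit v0 w p :
  p < size w -> (f (nth v0 w p) : nat) = numval f w %/ s ^ p %% s.
Proof.
have s0 : 0 < s by apply: ltnW.
elim: w p => // v w IH [_|p /= ltp] /=.
  by rewrite divn1 addnC mulnC modnMDl modn_small // word_lt.
rewrite expnS divnMA addnC (mulnC s) divnMDl //.
by rewrite (divn_small (word_lt v)) addn0 IH.
Qed.

Lemma numval_digits w V :
  uniq w -> V < s ^ size w ->
  {in w, forall v, f v = (V %/ s ^ index v w)%:R%R} -> numval f w = V.
Proof.
have s0 : 0 < s by apply: ltnW.
elim: w V => [V _|v w IH V] /=; first by rewrite ltnS leqn0 => /eqP ->.
case/andP => vw uw ltV fw.
rewrite fw ?mem_head // eqxx val_Zp_nat // divn1.
rewrite (IH (V %/ s)) //; first by rewrite mulnC addnC -divn_eq.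
  by rewrite ltn_divLR // mulnC -expnS.
move=> v' v'w; rewrite fw ?inE ?v'w ?orbT // -divnMA -expnS.
by case: eqVneq v'w => // <-; rewrite (negbTE vw).
Qed.

Lemma numval_take w b : numval f w < s ^ b -> numval f (take b w) = numval f w.
Proof.
have s0 : 0 < s by apply: ltnW.
have [ltb|geb] := ltnP b (size w); last by rewrite take_oversize.
rewrite -{1 3}(cat_take_drop b w) numval_cat size_takel; last exact: ltnW.
case: (numval f (drop b w)) => [|m]; first by rewrite muln0 addn0.
by rewrite mulnS => lt; exfalso; lia.
Qed.

Lemma numval_drop w b : numval f w < s ^ b -> numval f (drop b w) = 0.
Proof.
have s0 : 0 < s by apply: ltnW.
have [ltb|geb] := ltnP b (size w); last by rewrite drop_oversize.
rewrite -{1}(cat_take_drop b w) numval_cat size_takel; last exact: ltnW.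
by case: (numval f (drop b w)) => // m; rewrite mulnS => lt; exfalso; lia.
Qed.

End Numval.

Definition digit s (V p : nat) : 'Z_s := (V %/ s ^ p)%:R%R.

(** * Runs with prescribed operands *)

Section InputRun.

Variables (s : nat) (G : cdag s) (n : nat) (S : site G n).
Hypothesis s1 : 1 < s.
Hypothesis uS : uniq ((inA S : seq G) ++ inB S).

Definition input_run (a b : nat) : G -> 'Z_s :=
  eval (ins S) (fun v => if v \in inA S then digit s a (index v (inA S))
                         else digit s b (index v (inB S))).

Lemma input_run_run a b : run_values (ins S) (input_run a b).
Proof. exact: eval_run. Qed.

Lemma in_insA v : v \in inA S -> v \in ins S.
Proof. by rewrite inE mem_cat => ->. Qed.

Lemma in_insB v : v \in inB S -> v \in ins S.
Proof. by rewrite inE mem_cat orbC => ->. Qed.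

Lemma input_run_A a b v : v \in inA S -> input_run a b v = digit s a (index v (inA S)).
Proof. by move=> vA; rewrite /input_run eval_in ?in_insA // vA. Qed.

Lemma input_run_B a b v : v \in inB S -> input_run a b v = digit s b (index v (inB S)).
Proof.
move=> vB; rewrite /input_run eval_in ?in_insB //; case: ifP => // vA.
by move: uS; rewrite cat_uniq => /and3P [_ /hasPn /(_ v vB)]; rewrite /= vA.
Qed.

Lemma uniq_inA : uniq (inA S).
Proof. by move: uS; rewrite cat_uniq => /and3P []. Qed.

Lemma uniq_inB : uniq (inB S).
Proof. by move: uS; rewrite cat_uniq => /and3P []. Qed.

Lemma numval_input_A a b : a < s ^ n -> numval (input_run a b) (inA S) = a.
Proof.
move=> lta; apply: numval_digits; rewrite ?size_tuple ?uniq_inA //.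
by move=> v /input_run_A ->.
Qed.

Lemma numval_input_B a b : b < s ^ n -> numval (input_run a b) (inB S) = b.
Proof.
move=> ltb; apply: numval_digits; rewrite ?size_tuple ?uniq_inB //.
by move=> v /input_run_B ->.
Qed.

End InputRun.

(** * Decomposition into maximal sub-problems *)

Lemma implements_ok s (G : cdag s) (X : {set G}) n (t : instr n) (S : site G n) :
  implements X t S -> site_ok S /\ multiplies X S.
Proof. by case: t S => [m|m k x sz sub] S [okS mulS]. Qed.

Lemma sroot_in (T : eqType) (t : sumtree T) :
  (sroot t \in sleaves t) || (sroot t \in sinner t).
Proof. by case: t => [v|v b l r] /=; rewrite inE eqxx ?orbT. Qed.

Lemma sumtree_operands s (G : cdag s) (t : sumtree G) u v :
  sumtree_ok t -> v \in sinner t -> edge u v ->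
  (u \in sleaves t) || (u \in sinner t).
Proof.
elim: t => [//|w b l IHl r IHr] /= [eE _ okl okr].
rewrite inE mem_cat => /or3P [/eqP ->|vl|vr] uv.
- move: uv; rewrite eE mem_cat inE mem_cat.
  by case/orP => /eqP ->; [have := sroot_in l|have := sroot_in r] => /orP [] ->;
    rewrite ?orbT.
- by have := IHl okl vl uv; rewrite mem_cat inE mem_cat => /orP [] ->; rewrite ?orbT.
- by have := IHr okr vr uv; rewrite mem_cat inE mem_cat => /orP [] ->; rewrite ?orbT.
Qed.

Lemma ins_cases (T : finType) n (S : site T n) u :
  u \in ins S -> u \in inA S \/ u \in inB S.
Proof. by rewrite inE mem_cat => /orP. Qed.

Lemma standard_closed s (G : cdag s) n (S : site G n) :
  standard S -> forall u v, v \in body S -> edge u v -> u \in ins S \/ u \in body S.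
Proof.
case=> mul [tree [rl std]] u v vS uv.
case e: (rl v) => [i j|c|c].
- have [i' [j' ev]] := std_mul_all std vS e.
  move: uv; rewrite ev (std_mul_edge std) => /orP [] /eqP ->; left.
    by rewrite in_insA ?mem_tnth.
  by rewrite in_insB ?mem_tnth.
- have ltc := std_tree_sum std vS e; pose c' := Ordinal ltc.
  have vt : v \in sinner (tree c') by apply/(std_tree_inner std).
  have /orP [ul|ui] := sumtree_operands (std_tree_ok std c') vt uv.
    right; have [[i [j [_ ->]]]|[]//] := std_tree_leaves std ul.
    exact: (std_mul_body std).
  by right; have /(std_tree_inner std) [] := ui.
- have [/mem_take uA|/mem_take uB|[uS _]] := std_carry std vS e uv; last by right.
    by left; apply: in_insA.
  by left; apply: in_insB.
Qed.

Lemma toom_body s (G : cdag s) (X : {set G}) n (S : site G n) k x m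
    (D : forall l, site G (m l)) stg (coef : 'I_(npoints k) -> seq G) l v :
  toom_step X S x D stg coef -> v \in body (D l) -> v \in body S.
Proof. by move=> ts /(toom_sub_body ts) []. Qed.

(** Each stage of a Toom step reads only operands of the step and words of its body; a sub-problem
    therefore sees the rest of the graph through its operands alone. *)
Lemma implements_closed s (G : cdag s) (X : {set G}) n (t : instr n) (S : site G n) :
  implements X t S ->
  forall u v, v \in body S -> edge u v -> u \in ins S \/ u \in body S.
Proof.
elim: t S => [m|m k x sz sub IH] S /=; first by case=> _ _; exact: standard_closed.
case=> _ _ [D [stg [coef [ts impD]]]] u v vS uv.
have okD l : site_ok (D l) by have [] := implements_ok (impD l).
have outS l w : w \in outC (D l) -> w \in body S.
  by move=> /(site_out_body (okD l)); exact: toom_body ts.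
have coefS i w : w \in coef i -> w \in body S.
  by move=> /(toom_coef ts) [[l /outS]|[]].
case e: (stg v) => [||l||].
- by have [/in_insA|[]] := toom_evalA_edge ts vS e uv; [left|right].
- by have [/in_insB|[]] := toom_evalB_edge ts vS e uv; [left|right].
- have vD : v \in body (D l) by apply/(toom_sub_body ts).
  have [/ins_cases [uA|uB]|uD] := IH l _ (impD l) u v vD uv.
  + by have [/in_insA|[]] := toom_sub_inA ts uA; [left|right].
  + by have [/in_insB|[]] := toom_sub_inB ts uB; [left|right].
  + by right; exact: toom_body ts uD.
- by have [[l /outS]|[]] := toom_interp_edge ts vS e uv; right.
- by have [[i /coefS]|[]] := toom_compose_edge ts vS e uv; right.
Qed.

(* The part of the evaluations outside of the nodes that reads the operand [w]
   of the whole problem; the operands [wI i] of the nodes belong to it. *)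
Record side s (G : cdag s) (X : {set G}) (w : seq G) (I : finType)
    (wI : I -> seq G) (len : I -> nat) (K : {set G}) : Prop := Side {
  side_in : forall i u, u \in wI i -> u \in w \/ u \in K;
  side_closed : forall u v, v \in K -> edge u v -> u \in w \/ u \in K;
  side_val : forall i f, run_values X f -> numval f w < s ^ len i ->
    numval f (wI i) = numval f w
}.

(** One Toom step as seen from one operand: [E] is its evaluation stage, [wJ j] is the operand of
    the [j]-th sub-problem and [b] is the block length. A number that fits in one block is passed on
    unchanged, and [len j i <= b] lets this continue down to the nodes. *)
Lemma side_glue s (G : cdag s) (X : {set G}) (w : seq G) (E : {set G}) (J : finType)
    (wJ : J -> seq G) (b : nat) (I : J -> finType) (wI : forall j, I j -> seq G)
    (len : forall j, I j -> nat) (K : J -> {set G}) :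
  1 < s ->
  (forall u v, v \in E -> edge u v -> u \in w \/ u \in E) ->
  (forall j u, u \in wJ j -> u \in w \/ u \in E) ->
  (forall j f, run_values X f -> numval f w < s ^ b ->
    numval f (wJ j) = numval f w) ->
  (forall j i, len j i <= b) ->
  (forall j, side X (wJ j) (@wI j) (len j) (K j)) ->
  side X w (fun p : {j : J & I j} => wI (tag p) (tagged p))
    (fun p => len (tag p) (tagged p)) (E :|: \bigcup_j K j).
Proof.
move=> s1 clE inE' valE leb sideJ.
have inK j u : u \in wJ j \/ u \in K j -> u \in w \/ u \in E :|: \bigcup_j K j.
  case=> [/inE' [|uE]|uK]; [by left|by right; rewrite inE uE|right].
  by rewrite inE; apply/orP; right; apply/bigcupP; exists j.
split=> [[j i] u /= /(side_in (sideJ j))|u v|[j i] f rf /= ltw]; first exact: inK.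
- rewrite inE => /orP [vE uv|/bigcupP [j _ vK] uv].
    by have [|uE] := clE _ _ vE uv; [left|right; rewrite inE uE].
  by apply: (inK j); apply: (side_closed (sideJ j)) vK uv.
- have ltb : numval f w < s ^ b by apply: leq_trans ltw _; rewrite leq_exp2l.
  by rewrite (side_val (sideJ j)) ?valE.
Qed.

Record node s (G : cdag s) := Node {
  nsize : nat;
  nsite : site G nsize;
  nstd : bool
}.
Arguments Node {s G nsize}.

(** The arbitrary [phi] in [dec_sum] covers both the number of maximal sub-problems and the sum of
    the squared sizes of those of type 1. [dec_card] expresses, in the form needed for counting,
    that the bodies of the nodes, [KA] and [KB] are pairwise disjoint parts of the body of [S]. The
    length [uphalf] in [dec_A] and [dec_B] is the number of digits that remain free in a node. *)
Record decomposed s (G : cdag s) (X : {set G}) n (S : site G n) (t : instr n)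
    (n0 : nat) (I : finType) (N : I -> node G) (KA KB : {set G}) : Prop := Decomposed {
  dec_sum : forall phi : nat -> bool -> nat,
    \sum_(p <- subproblems t | msp1 n0 p || msp2 n0 p) phi (tag p) (msp1 n0 p) =
    \sum_i phi (nsize (N i)) (nstd (N i));
  dec_size : forall i, n0 <= nsize (N i) <= n;
  dec_sub : forall i, body (nsite (N i)) \subset body S;
  dec_card : forall D : {set G},
    \sum_i #|D :&: body (nsite (N i))| + #|D :&: KA| + #|D :&: KB| <= #|D :&: body S|;
  dec_ok : forall i, site_ok (nsite (N i)) /\ multiplies X (nsite (N i));
  dec_closed : forall i u v, v \in body (nsite (N i)) -> edge u v ->
    u \in ins (nsite (N i)) \/ u \in body (nsite (N i));
  dec_std : forall i, nstd (N i) -> standard (nsite (N i));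
  dec_A : side X (inA S) (fun i => inA (nsite (N i))) (fun i => uphalf (nsize (N i))) KA;
  dec_B : side X (inB S) (fun i => inB (nsite (N i))) (fun i => uphalf (nsize (N i))) KB
}.

Lemma tag_subproblems n (t : instr n) p :
  admissible t -> List.In p (subproblems t) -> tag p <= n.
Proof.
elim: t p => [m|m k x sz sub IH] p /=; first by move=> _ [<-|[]].
case=> _ _ ltsz adm [<- //|]; rewrite /image_mem; elim: (enum_mem _) => //= l r IHr /List.in_app_iff [|//].
by move=> /(IH l _ (adm l)) /leq_trans -> //; have [_ /ltnW] := ltsz l.
Qed.

Lemma sum_subproblems_small n (t : instr n) n0 (phi : nat -> bool -> nat) :
  admissible t -> n < n0 ->
  \sum_(p <- subproblems t | msp1 n0 p || msp2 n0 p) phi (tag p) (msp1 n0 p) = 0.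
Proof.
move=> adm ltn0; have := fun p => @tag_subproblems n t p adm.
elim: (subproblems t) => [|p r IH] lep; first by rewrite big_nil.
rewrite big_cons IH => [|q qr]; last by apply: lep; right.
by rewrite /msp1 /msp2 leqNgt (leq_ltn_trans (lep p (or_introl erefl)) ltn0).
Qed.

Lemma sum_subproblems_toom n k (x : 'I_(npoints k) -> int) m
    (sub : forall l, instr (m l)) n0 (phi : nat -> bool -> nat) :
  let t := Toom n x sub in
  \sum_(p <- subproblems t | msp1 n0 p || msp2 n0 p) phi (tag p) (msp1 n0 p) =
  (if msp2 n0 (existT instr n t) then phi n false else 0) +
  \sum_l \sum_(p <- subproblems (sub l) | msp1 n0 p || msp2 n0 p)
     phi (tag p) (msp1 n0 p).
Proof.
have e1 : msp1 n0 (existT instr n (Toom n x sub)) = false by rewrite /msp1 andbF.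
rewrite /= big_cons e1 /= big_flatten big_map big_enum /=.
by case: ifP.
Qed.

Lemma decomposed_self s (G : cdag s) (X : {set G}) n (S : site G n) (t : instr n)
    (n0 : nat) (b : bool) :
  implements X t S -> n0 <= n -> (b -> standard S) ->
  (forall phi : nat -> bool -> nat,
    \sum_(p <- subproblems t | msp1 n0 p || msp2 n0 p) phi (tag p) (msp1 n0 p) = phi n b) ->
  decomposed X S t n0 (fun _ : unit => Node S b) set0 set0.
Proof.
move=> imp len0 stdS sumt; have okS := implements_ok imp.
split=> //=.
- by move=> phi; rewrite sumt big_const card_unit /= addn0.
- by move=> _; rewrite len0 /=.
- by move=> D; rewrite !setI0 cards0 !addn0 big_const card_unit /= addn0.
- by move=> _; exact: implements_closed imp.
- by split=> // [i u|u v]; [left|rewrite inE].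
- by split=> // [i u|u v]; [left|rewrite inE].
Qed.

(** Only the lowest block is non-zero, so the polynomial is constant. *)
Lemma block_poly_small s (G : cdag s) (f : G -> 'Z_s) n k (A : n.-tuple G) (y : int) :
  1 < s -> 0 < k -> numval f A < s ^ block_len n k ->
  `|(block_poly f k A).[y]%R|%N = numval f A.
Proof.
move=> s1 k0 ltA.
have -> : block_poly f k A = ((numval f A)%:Z%:P)%R.
  apply/polyP => j; rewrite coef_poly coefC /blockval; case: j => [|j] /=.
    by rewrite k0 mul0n drop0 numval_take.
  have s0 : 0 < s by apply: ltnW.
  have d0 : numval f (drop (j.+1 * block_len n k) A) = 0.
    apply: numval_drop => //; apply: leq_trans ltA _.
    by rewrite leq_exp2l // mulSn leq_addr.
  by rewrite numval_take ?d0 ?if_same // expn_gt0 s0.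
by rewrite hornerC absz_nat.
Qed.

(** This is where the bound 2n/k on the sizes of sub-problems enters: half the length of a
    sub-problem fits in one block. *)
Lemma uphalf_block_len n k m m' :
  2 <= k -> k * m <= 2 * n -> m' <= m -> uphalf m' <= block_len n k.
Proof.
move=> k2 lekm lem; rewrite /block_len leq_divRL; last exact: ltnW.
have : 2 * uphalf m' <= m + 1 by lia.
by case: k k2 lekm => // k; nia.
Qed.

(** Induction on the plan. A standard problem is a node or too small; a Toom step of type 2 is a
    node, and nothing below it counts; for any other Toom step the nodes of the sub-problems are
    collected, and its own evaluations join the sides [KA] and [KB]. *)
Lemma decompose s (G : cdag s) (X : {set G}) n (t : instr n) (S : site G n) n0 :
  1 < s -> admissible t -> implements X t S ->
  exists (I : finType) (N : I -> node G) (KA KB : {set G}), decomposed X S t n0 N KA KB.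
Proof.
move=> s1; elim: t S => [m|m k x sz sub IH] S.
  move=> _ imp; case: (leqP n0 m) => [le_m|lt_m].
    exists unit, (fun _ => Node S true), set0, set0; apply: (decomposed_self imp) => //.
      by move=> _; case: imp.
    by move=> phi; rewrite big_cons big_nil /msp1 /= le_m /= addn0.
  exists 'I_0, (fun _ => Node S false), set0, set0; split=> //.
  - move=> phi; rewrite big_ord0; exact: sum_subproblems_small.
  - by case.
  - by move=> D; rewrite big_ord0 !setI0 cards0.
  - by case.
  - by case.
  - by split=> [[]|u v|[]] //; rewrite inE.
  - by split=> [[]|u v|[]] //; rewrite inE.
move=> adm imp; have [k2 _ sz_k adm_sub] := adm.
have [m2|m2] := boolP (msp2 n0 (existT instr m (Toom m x sub))).
  exists unit, (fun _ => Node S false), set0, set0.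
  have [le_m /forallP lt_sz] := andP m2; apply: (decomposed_self imp) => // phi.
  rewrite sum_subproblems_toom m2 big1 ?addn0 // => l _.
  exact: (sum_subproblems_small phi (adm_sub l) (lt_sz l)).
have [okS mulS [D [stg [coef [ts impD]]]]] := imp.
have {}IH l := IH l (D l) (adm_sub l) (impD l).
have [I {}IH] := fin_all_exists IH.
have [N {}IH] := fin_all_exists IH.
have [KA {}IH] := fin_all_exists IH.
have [KB {}IH] := fin_all_exists IH.
pose EA := [set v in body S | if stg v is EvalA then true else false].
pose EB := [set v in body S | if stg v is EvalB then true else false].
pose W l := [set v in body S | if stg v is SubProblem l' then l' == l else false].
have inEA v : v \in body S /\ stg v = EvalA -> v \in EA.
  by case=> vS e; rewrite inE vS e.
have inEB v : v \in body S /\ stg v = EvalB -> v \in EB.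
  by case=> vS e; rewrite inE vS e.
have bodyD l : body (D l) = W l.
  apply/setP => v; apply/idP/idP => [/(toom_sub_body ts) [vS e]|].
    by rewrite inE vS e /=.
  rewrite inE => /andP [vS]; case e: (stg v) => [||l'||] // /eqP e'.
  by apply/(toom_sub_body ts); rewrite e e'.
have lenI l (i : I l) : uphalf (nsize (N l i)) <= block_len m k.
  have /andP [_ le_i] := dec_size (IH l) i.
  by have [lek _] := sz_k l; exact: uphalf_block_len lek le_i.
pose NN (p : {l : 'I_(npoints k) & I l}) := N (tag p) (tagged p).
exists {l : 'I_(npoints k) & I l}, NN, (EA :|: \bigcup_l KA l), (EB :|: \bigcup_l KB l).
have s0 : 0 < s by apply: ltnW.
have k0 : 0 < k by apply: ltnW.
split.
- move=> phi; rewrite sum_subproblems_toom (negbTE m2) add0n.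
  rewrite (eq_bigr _ (fun l _ => dec_sum (IH l) phi)).
  by rewrite (sig_big_dep _ _ (fun l i => phi (nsize (N l i)) (nstd (N l i)))).
- case=> l i; rewrite /NN /=; have /andP [-> le_i] := dec_size (IH l) i.
  by apply: leq_trans le_i _; have [_ /ltnW] := sz_k l.
- case=> l i; rewrite /NN /=; apply: subset_trans (dec_sub (IH l) i) _.
  by apply/subsetP => v; exact: toom_body ts.
- move=> E.
  have -> : \sum_p #|E :&: body (nsite (NN p))| =
            \sum_l \sum_i #|E :&: body (nsite (N l i))|.
    by rewrite (sig_big_dep _ _ (fun l i => #|E :&: body (nsite (N l i))|)).
  have leU (F : {set G}) (K : 'I_(npoints k) -> {set G}) :
      #|E :&: (F :|: \bigcup_l K l)| <= #|E :&: F| + \sum_l #|E :&: K l|.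
    rewrite setIUr; apply: leq_trans (leq_card_setU _ _) _; rewrite leq_add2l.
    rewrite -[X in X <= _]addn0.
    elim/big_rec2: _ => [|l y F' _ IHl]; first by rewrite setI0 cards0.
    by rewrite setIUr; apply: leq_trans (leq_add (leq_card_setU _ _) (leqnn 0)) _; lia.
  have leW : \sum_l (\sum_i #|E :&: body (nsite (N l i))| + #|E :&: KA l| + #|E :&: KB l|)
             <= \sum_l #|E :&: W l|.
    by apply: leq_sum => l _; rewrite -bodyD; exact: dec_card (IH l) E.
  (* A vertex has only one stage, so the left-hand side counts it at most once. *)
  have card_part : #|E :&: EA| + #|E :&: EB| + \sum_l #|E :&: W l| <= #|E :&: body S|.
    have cardE (F : {set G}) : F \subset body S ->
        #|E :&: F| = \sum_(v in E :&: body S) (v \in F).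
      move=> FS; rewrite -sum1_card big_mkcond [RHS]big_mkcond /=.
      apply: eq_bigr => v _; rewrite !inE; case: (v \in E) => //=.
      by case vF: (v \in F); rewrite ?(subsetP FS v vF) ?if_same.
    have EAS : EA \subset body S by apply/subsetP => v; rewrite inE => /andP [].
    have EBS : EB \subset body S by apply/subsetP => v; rewrite inE => /andP [].
    have WS l : W l \subset body S by apply/subsetP => v; rewrite inE => /andP [].
    rewrite (cardE _ EAS) (cardE _ EBS) (eq_bigr _ (fun l _ => cardE _ (WS l))).
    rewrite exchange_big -!big_split /= -sum1_card; apply: leq_sum => v.
    rewrite inE => /andP [_ vS]; rewrite ![v \in [set _ | _]]inE vS /=.
    have -> : \sum_l (v \in W l) = if stg v is SubProblem _ then 1 else 0.
      case e: (stg v) => [||l'||]; do ?[by rewrite big1 // => l _; rewrite inE vS e].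
      rewrite (bigD1 l') //= big1 => [|l /negbTE nel]; rewrite inE vS e ?eqxx //.
      by rewrite eq_sym nel.
    by case: (stg v).
  have arith y0 y z w a b u v t : y0 + y + z <= w -> u <= a + y -> v <= b + z ->
      a + b + w <= t -> y0 + u + v <= t by lia.
  apply: arith (leU EA KA) (leU EB KB) card_part.
  by move: leW; rewrite !big_split.
- case=> l i; exact: dec_ok (IH l) i.
- case=> l i; exact: dec_closed (IH l) i.
- case=> l i; exact: dec_std (IH l) i.
- apply: (@side_glue _ _ _ _ EA _ (fun l => inA (D l)) (block_len m k) I
    (fun l i => inA (nsite (N l i))) (fun l i => uphalf (nsize (N l i))) KA) => //.
  + move=> u v; rewrite inE => /andP [vS]; case e: (stg v) => [||l'||] // _ uv.
    by have [|/inEA] := toom_evalA_edge ts vS e uv; [left|right].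
  + by move=> l u /(toom_sub_inA ts) [|/inEA]; [left|right].
  + by move=> l f rf lt; rewrite (toom_evalA ts l rf) block_poly_small.
  + by move=> l; exact: dec_A (IH l).
- apply: (@side_glue _ _ _ _ EB _ (fun l => inB (D l)) (block_len m k) I
    (fun l i => inB (nsite (N l i))) (fun l i => uphalf (nsize (N l i))) KB) => //.
  + move=> u v; rewrite inE => /andP [vS]; case e: (stg v) => [||l'||] // _ uv.
    by have [|/inEB] := toom_evalB_edge ts vS e uv; [left|right].
  + by move=> l u /(toom_sub_inB ts) [|/inEB]; [left|right].
  + by move=> l f rf lt; rewrite (toom_evalB ts l rf) block_poly_small.
  + by move=> l; exact: dec_B (IH l).
Qed.

(** * Information flow through one sub-problem *)

Definition dsum s h (w : {ffun 'I_h -> 'Z_s}) : nat := \sum_(i < h) w i * s ^ i.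

Lemma dsum_lt s h (w : {ffun 'I_h -> 'Z_s}) : 1 < s -> dsum w < s ^ h.
Proof.
move=> s1; rewrite /dsum; elim: h w => [|h IH] w; first by rewrite big_ord0.
rewrite big_ord_recr /= expnS.
have : \sum_(i < h) w (widen_ord (leqnSn h) i) * s ^ i < s ^ h.
  apply: leq_ltn_trans (IH [ffun i => w (widen_ord (leqnSn h) i)]).
  by apply: leq_sum => i _; rewrite ffunE.
have ltw : w ord_max < s.
  by have := ltn_ord (w ord_max); rewrite [in X in _ < X -> _]Zp_cast.
have arith a b c : a < c -> b < s -> a + b * c < s * c by nia.
by move=> ltS; exact: arith ltS ltw.
Qed.

Lemma dsum_digit s h (w : {ffun 'I_h -> 'Z_s}) (p : 'I_h) :
  1 < s -> dsum w %/ s ^ p %% s = w p.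
Proof.
move=> s1; have s0 : 0 < s by apply: ltnW.
rewrite /dsum; elim: h w p => [|h IH] w p; first by case: p.
rewrite big_ord_recl /= muln1.
have -> : \sum_(i < h) w (lift ord0 i) * s ^ bump 0 i =
          s * dsum [ffun i => w (lift ord0 i)].
  by rewrite big_distrr; apply: eq_bigr => i _; rewrite ffunE /bump add1n expnS mulnCA.
have ltw : w ord0 < s by have := ltn_ord (w ord0); rewrite [in X in _ < X -> _]Zp_cast.
case: (unliftP ord0 p) => [p' ->|->] /=.
  rewrite /bump add1n expnS divnMA addnC mulnC divnMDl //.
  by rewrite (divn_small ltw) addn0 IH ffunE.
by rewrite divn1 addnC mulnC modnMDl modn_small.
Qed.

Lemma val_ord_sub h (z j : 'I_h.+1) : ((z - j)%R : nat) = (h.+1 + z - j) %% h.+1.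
Proof.
by rewrite /= modnDmr; congr (_ %% _); have := ltn_ord j; lia.
Qed.

(* Multiplying a word of [h] digits by [s ^ j + s ^ (j + h)] writes it twice in a row. *)
Lemma repeated_digit s h (w : {ffun 'I_h.+1 -> 'Z_s}) o (z j : 'I_h.+1) : 1 < s ->
  (s ^ o * dsum w) * (s ^ j + s ^ (j + h.+1)) %/ s ^ (o + h.+1 + z) %% s = w (z - j)%R.
Proof.
move=> s1; have s0 : 0 < s by apply: ltnW.
have ltw := dsum_lt w s1; set V := dsum w in ltw *.
have -> : s ^ o * V * (s ^ j + s ^ (j + h.+1)) =
          s ^ (o + j) * (V + V * s ^ h.+1) by rewrite !expnD; lia.
have -> : o + h.+1 + z = (o + j) + (h.+1 + z - j) by have := ltn_ord j; lia.
rewrite [s ^ (o + j + _)]expnD divnMl ?expn_gt0 ?s0 //.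
rewrite -(dsum_digit (w) (z - j)%R s1) -/V val_ord_sub.
(* The digit comes from the upper copy of [w] if [j <= z], and from the lower copy otherwise. *)
have [ge_h|lt_h] := leqP h.+1 (h.+1 + z - j).
  set q := h.+1 + z - j - h.+1.
  have eq : h.+1 + z - j = h.+1 + q by rewrite subnKC.
  rewrite eq modnDl expnD divnMA addnC divnMDl ?expn_gt0 ?s0 //.
  have ltq : q < h.+1 by have := ltn_ord z; rewrite /q; lia.
  by rewrite (divn_small ltw) addn0 (modn_small ltq).
rewrite (modn_small lt_h); set q := h.+1 + z - j in lt_h *.
have -> : V * s ^ h.+1 = V * s ^ (h.+1 - q).-1 * s * s ^ q.
  by rewrite -!mulnA -expnS -expnD; congr (_ * s ^ _); lia.
by rewrite addnC divnMDl ?expn_gt0 ?s0 // modnMDl.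
Qed.

(** Filling up with 0 puts the contents of all sets [D] into one finite type, while at most
    [s ^ #|D|] of them are possible. *)
Definition masked s (G : cdag s) (D : {set G}) (f : G -> 'Z_s) : {ffun G -> 'Z_s} :=
  [ffun v => if v \in D then f v else 0%R].

Lemma mask_eq s (G : cdag s) (D : {set G}) (f g : G -> 'Z_s) :
  masked D f = masked D g -> {in D, f =1 g}.
Proof. by move=> /ffunP e v vD; have := e v; rewrite !ffunE vD. Qed.

Lemma card_mask s (G : cdag s) (D : {set G}) (Y : finType) (A : {pred Y})
    (f : Y -> G -> 'Z_s) :
  1 < s -> #|[set masked D (f y) | y in A]| <= s ^ #|D|.
Proof.
move=> s1; have -> : s ^ #|D| = #|pffun_on (0%R : 'Z_s) (mem D) predT|.
  by rewrite card_pffun_on card_ord Zp_cast.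
apply/subset_leq_card/subsetP => g /imsetP [y _ ->].
apply/pffun_onP; split => [|?]; last by [].
by apply/supportP => v vD; rewrite ffunE (negbTE vD).
Qed.

(** An instance of [cyclic_info]. [K1] is the side of the unknown word [w], [K2] that of the shift
    [j], and [bd] the body of the node. Words of [K1] do not depend on [j] and play the part of
    [fa]; those of [bd] play the part of [fd j]; those of [K2] depend on [j] only and reveal nothing
    about [w]. *)
Lemma window_bound_core s (G : cdag s) (X D T K1 K2 bd : {set G}) h m lo
    (out : (m + m).-tuple G) (R : {ffun 'I_h.+1 -> 'Z_s} -> 'I_h.+1 -> G -> 'Z_s) :
  1 < s -> supported X D T ->
  (forall w j, run_values X (R w j)) ->
  (forall w j j', {in K1, R w j =1 R w j'}) ->
  (forall w w' j, {in K2, R w j =1 R w' j}) ->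
  (forall u v, v \in bd :|: K1 :|: K2 -> v \notin X -> edge u v ->
     u \in bd :|: K1 :|: K2) ->
  {subset out <= bd} ->
  (forall w j (c : 'I_(m + m)) (z : 'I_h.+1), c = lo + z :> nat ->
     R w j (tnth out c) = w (z - j)%R) ->
  #|[set c : 'I_(m + m) | (lo <= c < lo + h.+1) && (tnth out c \in T)]| *
    (h.+1 - #|D :&: K1|) <= h.+1 * #|D :&: bd|.
Proof.
move=> s1 supT runR R1 R2 clK outS outR.
set Zc := [set c | _].
pose Z : {set 'I_h.+1} := [set inord (c - lo) | c : 'I_(m + m) in Zc].
have -> : #|Zc| = #|Z|.
  rewrite card_in_imset // => c c'; rewrite !inE => /andP [/andP [c1 c2] _].
  move=> /andP [/andP [c3 c4] _] /(congr1 val); rewrite /= !inordK; try lia.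
  by move=> e; apply: val_inj => /=; lia.
have T1 : #|'Z_s| = s by rewrite card_ord Zp_cast.
(* The shift [ord0] represents all shifts, since the words of [K1] are the same for each of them. *)
apply: (@cyclic_info h _ _ 'Z_s _ _ Z (fun w => masked (D :&: K1) (R w ord0))
          (fun j w => masked (D :&: bd) (R w j))); rewrite ?T1 //.
- exact: card_mask.
- by move=> j; exact: card_mask.
move=> j w w' /mask_eq e1 /mask_eq e2 z /imsetP [c].
rewrite !inE => /andP [/andP [c1 c2] cT] ez.
have ec : c = lo + z :> nat by rewrite ez inordK; lia.
rewrite -(outR w j c z ec) -(outR w' j c z ec).
apply: (supported_eq (runR w j) (runR w' j) (supportedI supT clK)); last first.
  by rewrite !inE cT outS ?mem_tnth.
move=> v; rewrite !inE => /andP [vD] /orP [/orP [vb|v1]|v2].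
- by apply: e2; rewrite inE vD.
- by rewrite (R1 w j ord0) // (R1 w' j ord0) // e1 // inE vD.
- exact: R2.
Qed.

Lemma uphalf_le m : uphalf m <= m.
Proof. by lia. Qed.

(** * What a supported set knows about one maximal sub-problem *)

Section Nodes.

Variables (s : nat) (G : cdag s) (n : nat) (S : site G n) (t : instr n) (n0 : nat).
Variables (I : finType) (N : I -> node G) (KA KB : {set G}).
Hypotheses (s1 : 1 < s) (okS : site_ok S).
Hypothesis dec : decomposed (ins S) S t n0 N KA KB.

Let X := ins S.
Let uS := site_in_uniq okS.

Definition sideA : {set G} := KA :|: [set v in inA S].
Definition sideB : {set G} := KB :|: [set v in inB S].

Lemma subset_of_card (T : finType) (K B : {set T}) :
  (forall D : {set T}, #|D :&: K| <= #|D :&: B|) -> K \subset B.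
Proof.
move=> le; apply/subsetP => v vK; have := le [set v].
rewrite (setIidPl (_ : [set v] \subset K)) ?sub1set // cards1.
by case/card_gt0P => w; rewrite !inE => /andP [/eqP ->].
Qed.

Lemma KA_body : KA \subset body S.
Proof. by apply: subset_of_card => D; have := dec_card dec D; lia. Qed.

Lemma KB_body : KB \subset body S.
Proof. by apply: subset_of_card => D; have := dec_card dec D; lia. Qed.

Lemma body_notin_ins v : v \in body S -> v \notin X.
Proof.
move=> vS; apply/negP => vX; have := site_disjoint okS.
by move=> /pred0P /(_ v) /=; rewrite vX vS.
Qed.

Lemma sideA_closed u v : v \in sideA -> v \notin X -> edge u v -> u \in sideA.
Proof.
move=> vA vX uv; have vK : v \in KA.
  by move: vA; rewrite !inE => /orP [//|/in_insA vA]; case/negP: vX.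
rewrite !inE.
by have [->|->] := side_closed (dec_A dec) vK uv; rewrite ?orbT.
Qed.

Lemma sideB_closed u v : v \in sideB -> v \notin X -> edge u v -> u \in sideB.
Proof.
move=> vA vX uv; have vK : v \in KB.
  by move: vA; rewrite !inE => /orP [//|/in_insB vA]; case/negP: vX.
rewrite !inE.
by have [->|->] := side_closed (dec_B dec) vK uv; rewrite ?orbT.
Qed.

Lemma sideA_run a b b' : {in sideA, input_run S a b =1 input_run S a b'}.
Proof.
apply: (supported_eq (X := X) (D := [set v in inA S])); try exact: input_run_run.
- move=> v vA; have [v1|v1] := boolP (v \in inA S); [by left; rewrite inE|right].
  have vK : v \in KA by move: vA; rewrite !inE (negbTE v1) orbF.
  have vX := body_notin_ins (subsetP KA_body v vK).
  by split=> // u; exact: sideA_closed.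
- by move=> v; rewrite inE => vA; rewrite !input_run_A.
Qed.

Lemma sideB_run a a' b : {in sideB, input_run S a b =1 input_run S a' b}.
Proof.
apply: (supported_eq (X := X) (D := [set v in inB S])); try exact: input_run_run.
- move=> v vA; have [v1|v1] := boolP (v \in inB S); [by left; rewrite inE|right].
  have vK : v \in KB by move: vA; rewrite !inE (negbTE v1) orbF.
  have vX := body_notin_ins (subsetP KB_body v vK).
  by split=> // u; exact: sideB_closed.
- by move=> v; rewrite inE => vA; rewrite !input_run_B.
Qed.

Variable i : I.
Let m := nsize (N i).
Let P : site G m := nsite (N i).

Lemma half_le : uphalf m <= n.
Proof. by have /andP [_] := dec_size dec i; rewrite -/m; lia. Qed.

Lemma free_lt_top a : a < s ^ uphalf m -> a < s ^ n.
Proof. by move=> /leq_trans -> //; rewrite leq_exp2l // half_le. Qed.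

Lemma numval_nodeA a b : a < s ^ uphalf m -> numval (input_run S a b) (inA P) = a.
Proof.
move=> lta; have numA := numval_input_A s1 uS b (free_lt_top lta).
by rewrite (side_val (dec_A dec)) ?numA //; exact: input_run_run.
Qed.

Lemma numval_nodeB a b : b < s ^ uphalf m -> numval (input_run S a b) (inB P) = b.
Proof.
move=> ltb; have numB := numval_input_B s1 uS a (free_lt_top ltb).
by rewrite (side_val (dec_B dec)) ?numB //; exact: input_run_run.
Qed.

Lemma node_output a b (c : 'I_(m + m)) : a < s ^ uphalf m -> b < s ^ uphalf m ->
  input_run S a b (tnth (outC P) c) = a * b %/ s ^ c %% s :> nat.
Proof.
move=> lta ltb; have [_ mulP] := dec_ok dec i.
rewrite (tnth_nth (tnth (outC P) c)) (numval_digit _ s1) ?size_tuple //.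
by rewrite mulP ?numval_nodeA ?numval_nodeB //; exact: input_run_run.
Qed.

Variables (D T : {set G}).
Hypothesis supT : supported X D T.

Definition window (lo h : nat) : {set 'I_(m + m)} :=
  [set c : 'I_(m + m) | (lo <= c < lo + h) && (tnth (outC P) c \in T)].

Lemma node_closed u v : v \in body P :|: sideA :|: sideB -> v \notin X -> edge u v ->
  u \in body P :|: sideA :|: sideB.
Proof.
have clA := @sideA_closed u v; have clB := @sideB_closed u v.
case/setUP => [/setUP [vP|vA]|vB] vX uv; apply/setUP.
- have [/ins_cases [uA|uB]|uP] := dec_closed dec vP uv.
  + left; apply/setUP; right.
    by have [uS'|uK] := side_in (dec_A dec) uA; rewrite !inE ?uS' ?uK ?orbT.
  + by right; have [uS'|uK] := side_in (dec_B dec) uB; rewrite !inE ?uS' ?uK ?orbT.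
  + by left; apply/setUP; left.
- by left; apply/setUP; right; apply: clA vA vX uv.
- by right; apply: clB vB vX uv.
Qed.

Lemma shift_lt h (j : 'I_h.+1) : s ^ j + s ^ (j + h.+1) < s ^ (h.+1 + h.+1).
Proof.
have lej : s ^ j <= s ^ h by rewrite leq_exp2l // -ltnS.
have : s ^ (j + h.+1) <= s ^ (h + h.+1) by rewrite leq_exp2l // leq_add2r -ltnS.
have : 0 < s ^ h by rewrite expn_gt0 ltnW.
have : s ^ h < s ^ (h + h.+1) by rewrite ltn_exp2l //; lia.
have : 2 * s ^ (h + h.+1) <= s ^ (h.+1 + h.+1) by rewrite addSn expnS leq_mul2r s1 orbT.
by lia.
Qed.

(** Either operand may carry the unknown word, hence the minimum over the two sides. The factor
    [s ^ o] moves the window of output positions; [h + h <= uphalf m] makes room for the other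
    factor [s ^ j + s ^ (j + h)]. *)
Lemma window_bound o h : 0 < h -> o + h <= uphalf m -> h + h <= uphalf m ->
  #|window (o + h) h| * (h - minn #|D :&: sideA| #|D :&: sideB|) <= h * #|D :&: body P|.
Proof.
case: h => // h _ leo leh; have outP := site_out_body (dec_ok dec i).1.
have ltw (w : {ffun 'I_h.+1 -> 'Z_s}) : s ^ o * dsum w < s ^ uphalf m.
  apply: (@leq_trans (s ^ o * s ^ h.+1)); last by rewrite -expnD leq_exp2l.
  by rewrite ltn_pmul2l ?dsum_lt // expn_gt0 ltnW.
have ltj (j : 'I_h.+1) : s ^ j + s ^ (j + h.+1) < s ^ uphalf m.
  by apply: leq_trans (shift_lt j) _; rewrite leq_exp2l.
have digitE w (j : 'I_h.+1) (x : 'Z_s) (c : 'I_(m + m)) (z : 'I_h.+1) :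
    c = o + h.+1 + z :> nat ->
    x = (s ^ o * dsum w) * (s ^ j + s ^ (j + h.+1)) %/ s ^ c %% s :> nat ->
    x = w (z - j)%R.
  by move=> -> ex; apply: val_inj; rewrite /= ex repeated_digit.
rewrite /minn; case: ltnP => _.
- apply: (@window_bound_core _ _ X D T sideA sideB (body P) h m _ (outC P)
    (fun w j => input_run S (s ^ o * dsum w) (s ^ j + s ^ (j + h.+1)))) => //.
  + by move=> *; exact: input_run_run.
  + by move=> *; exact: sideA_run.
  + by move=> *; exact: sideB_run.
  + exact: node_closed.
  + by move=> w j c z ec; apply: digitE ec _; rewrite node_output.
- apply: (@window_bound_core _ _ X D T sideB sideA (body P) h m _ (outC P)
    (fun w j => input_run S (s ^ j + s ^ (j + h.+1)) (s ^ o * dsum w))) => //.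
  + by move=> *; exact: input_run_run.
  + by move=> *; exact: sideB_run.
  + by move=> *; exact: sideA_run.
  + by move=> u v; rewrite setUAC => vK vX /(node_closed vK vX); rewrite setUAC.
  + by move=> w j c z ec; apply: digitE ec _; rewrite node_output // mulnC.
Qed.

(** The digits at the known positions can be chosen in [s ^ #|al|] ways, and different choices must
    leave different contents in [D :&: K]. *)
Lemma operand_bound (K : {set G}) (V : m.-tuple G) (R : nat -> G -> 'Z_s) :
  (forall u v, v \in K -> v \notin X -> edge u v -> u \in K) ->
  {subset V <= K} -> (forall a, run_values X (R a)) ->
  (forall a, a < s ^ uphalf m -> numval (R a) V = a) ->
  #|[set p : 'I_(uphalf m) | tnth V (widen_ord (uphalf_le m) p) \in T]| <= #|D :&: K|.
Proof.
move=> clK VK runR numR; set al := [set p | _].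
rewrite -(leq_exp2l _ _ s1).
have -> : s ^ #|al| = #|pffun_on (0%R : 'Z_s) (mem al) predT|.
  by rewrite card_pffun_on card_ord Zp_cast.
rewrite -(card_in_imset (f := fun w => masked (D :&: K) (R (dsum w)))).
  exact: card_mask.
move=> w w' /pffun_onP [w0 _] /pffun_onP [w'0 _] /mask_eq eqD.
apply/ffunP => p; have [pal|pal] := boolP (p \in al); last first.
  have /supportP e := w0; have /supportP e' := w'0.
  by rewrite e ?e'.
have eT := supported_eq (runR _) (runR _) (supportedI supT clK) eqD.
pose v := tnth V (widen_ord (uphalf_le m) p).
have vTK : v \in T :&: K by rewrite inE VK ?mem_tnth // andbT; move: pal; rewrite inE.
have valR (w1 : {ffun 'I_(uphalf m) -> 'Z_s}) : R (dsum w1) v = w1 p :> nat.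
  rewrite /v (tnth_nth v) (numval_digit _ s1) ?size_tuple /=; last first.
    by have := ltn_ord p; have := uphalf_le m; lia.
  by rewrite (numR _ (dsum_lt w1 s1)) dsum_digit.
by apply: val_inj; apply: etrans (esym (valR w)) _; rewrite eT // valR.
Qed.

Definition knownA : {set 'I_(uphalf m)} :=
  [set p | tnth (inA P) (widen_ord (uphalf_le m) p) \in T].
Definition knownB : {set 'I_(uphalf m)} :=
  [set p | tnth (inB P) (widen_ord (uphalf_le m) p) \in T].

Lemma knownA_bound : #|knownA| <= #|D :&: sideA|.
Proof.
apply: (operand_bound (R := fun a => input_run S a 0)).
- exact: sideA_closed.
- by move=> u /(side_in (dec_A dec)) [] u1; rewrite !inE u1 ?orbT.
- by move=> a; exact: input_run_run.
- by move=> a; exact: numval_nodeA.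
Qed.

Lemma knownB_bound : #|knownB| <= #|D :&: sideB|.
Proof.
apply: (operand_bound (R := fun a => input_run S 0 a)).
- exact: sideB_closed.
- by move=> u /(side_in (dec_B dec)) [] u1; rewrite !inE u1 ?orbT.
- by move=> a; exact: input_run_run.
- by move=> a; exact: numval_nodeB.
Qed.

End Nodes.

(** * Local traces *)

Lemma disjoint_setU (T : finType) (A B C : {set T}) :
  [disjoint A :|: B & C] = [disjoint A & C] && [disjoint B & C].
Proof. by rewrite -!setI_eq0 setIUl setU_eq0. Qed.

Lemma disjoint_set0 (T : finType) (A : {set T}) : [disjoint set0 & A].
Proof. by rewrite -setI_eq0 set0I. Qed.

(** Transfers are split into single words, so that a trace can be cut after any number of words;
    [Keep] only drops words. *)
Inductive event (V : Type) : Type := Keep | Comp of V | In of V | Out of V.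
Arguments Keep {V}.

Section Traces.

Variables (s : nat) (G : cdag s) (X : {set G}) (M : nat).

(* An event of one processor, with the contents of its memory afterwards. *)
Definition item : Type := event G * {set G}.
Implicit Types (l : seq item) (C T : {set G}).

Definition as_in (i : item) : option G := if i.1 is In v then Some v else None.
Definition as_out (i : item) : option G := if i.1 is Out v then Some v else None.
Definition as_comp (i : item) : option G := if i.1 is Comp v then Some v else None.
Definition ios l := count (fun i => as_in i) l + count (fun i => as_out i) l.

Definition events (sel : item -> option G) l : {set G} :=
  [set v | has (fun i => sel i == Some v) l].
Definition final C l : {set G} := last C (map snd l).

Fixpoint valid C l : Prop :=
  match l with
  | [::] => True
  | (e, C') :: l' =>
      [/\ #|C'| <= M,
          match e with
          | Keep => C' \subset C
          | Comp v => [/\ v \notin X, operands v \subset C & C' \subset v |: C]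
          | In v => C' \subset v |: C
          | Out v => v \in C /\ C' \subset C
          end
        & valid C' l']
  end.

Lemma ios_cat l1 l2 : ios (l1 ++ l2) = ios l1 + ios l2.
Proof. by rewrite /ios !count_cat; lia. Qed.

Lemma final_cat C l1 l2 : final C (l1 ++ l2) = final (final C l1) l2.
Proof. by rewrite /final map_cat last_cat. Qed.

Lemma events_cat sel l1 l2 : events sel (l1 ++ l2) = events sel l1 :|: events sel l2.
Proof. by apply/setP => v; rewrite !inE has_cat. Qed.

Lemma events_cons sel i l :
  events sel (i :: l) = (if sel i is Some v then [set v] else set0) :|: events sel l.
Proof.
apply/setP => v; rewrite !inE /=; case: (sel i) => [u|]; rewrite !inE //=.
by rewrite [v == u]eq_sym.
Qed.

Lemma card_events sel l : #|events sel l| <= count (fun i => sel i) l.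
Proof.
elim: l => [|i l IH] /=.
  by rewrite (_ : events sel [::] = set0) ?cards0 //; apply/setP => v; rewrite !inE.
rewrite events_cons; apply: leq_trans (leq_card_setU _ _) (leq_add _ IH).
by case: (sel i) => [u|]; rewrite ?cards1 ?cards0.
Qed.

Lemma valid_cat C l1 l2 : valid C (l1 ++ l2) <-> valid C l1 /\ valid (final C l1) l2.
Proof.
elim: l1 C => [|[e C'] l1 IH] C /=; first by split=> [|[]].
by split=> [[? ? /IH []]|[[? ? ?] ?]]; split=> //; apply/IH.
Qed.

Lemma final_le C l : #|C| <= M -> valid C l -> #|final C l| <= M.
Proof. by elim: l C => [|[e C'] l IH] C //= _ [leC' _ /(IH _ leC')]. Qed.

Lemma valid_support C T l : valid C l -> C \subset T ->
  events as_in l \subset T -> events as_comp l \subset T ->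
  final C l \subset T /\
  forall v, v \in events as_comp l -> v \notin X /\ forall u, edge u v -> u \in T.
Proof.
elim: l C => [|[e C'] l IH] C /=; first by move=> _ CT _ _; split=> // v; rewrite inE.
case=> _ stp val CT; rewrite !events_cons !subUset => /andP [inT InT] /andP [cT CompT].
have C'T : C' \subset T.
  case: e stp inT cT => [sC'|v [_ _ sC']|v sC'|v [_ sC']] /= inT cT.
  - exact: subset_trans CT.
  - by apply: subset_trans sC' _; rewrite subUset cT.
  - by apply: subset_trans sC' _; rewrite subUset inT.
  - exact: subset_trans CT.
have [finT compP] := IH C' val C'T InT CompT; split=> // v.
case/setUP => [|/compP //]; case: e stp {inT cT} => [|w|w|w] //=; rewrite ?inE //.
case=> wX opw _ /eqP ->; split=> // u uw; apply: (subsetP CT).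
by apply: (subsetP opw); rewrite inE.
Qed.

(** Everything that is ever in memory or computed during a trace is a function of the initial memory
    and the words loaded, however often words are recomputed. *)
Lemma valid_supported C l : valid C l ->
  let D := C :|: events as_in l in
  let T := D :|: events as_comp l in
  [/\ supported X D T, final C l \subset T &
    forall u v, v \in events as_comp l -> edge u v -> u \in T].
Proof.
move=> val D T; have [finT compP] : final C l \subset T /\
    forall v, v \in events as_comp l -> v \notin X /\ forall u, edge u v -> u \in T.
  by apply: valid_support val _ _ _; rewrite /T /D ?subsetUr // -?setUA ?subsetUl //
    setUCA subsetUl.
split=> // [v /setUP [|/compP]|u v /compP [_]]; [by left|by right|exact].
Qed.

(* Unless words of [K] have been read before, none is written. *)
Fixpoint silent (K : {set G}) l : Prop :=
  match l with
  | [::] => True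
  | (e, _) :: l' =>
      match e with
      | In v => v \notin K -> silent K l'
      | Out v => v \notin K /\ silent K l'
      | _ => silent K l'
      end
  end.

Definition unread (K : {set G}) l : Prop := [disjoint events as_in l & K].

Lemma silent_cat K l1 l2 :
  silent K l1 -> (unread K l1 -> silent K l2) -> silent K (l1 ++ l2).
Proof.
elim: l1 => [|[e C'] l1 IH] /=; first by move=> _; apply; apply/pred0P => v; rewrite /= !inE.
have unreadE : unread K ((e, C') :: l1) <->
    unread K l1 /\ if e is In v then v \notin K else True.
  rewrite /unread events_cons disjoint_setU; case: e => [|v|v|v] /=.
  all: rewrite ?disjoints1 ?disjoint_set0.
  1,2,4: by split=> // -[].
  by split=> [/andP []|[-> ->]].
case: e unreadE => [|v|v|v] E.
- by move=> sl l2P; apply: IH => // u; apply: l2P; apply/E.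
- by move=> sl l2P; apply: IH => // u; apply: l2P; apply/E.
- by move=> sl l2P vK; apply: IH; [exact: sl|move=> u; apply: l2P; apply/E].
- by case=> vK sl l2P; split=> //; apply: IH => // u; apply: l2P; apply/E.
Qed.

Section Path.

(* [K] is a chain of operations leading from [a] to another vertex. *)
Variables (K : {set G}) (a : G).
Hypothesis stepK : forall v, v \in K -> v = a \/ exists2 u, edge u v & u \in K.

Lemma comp_path C v : v \in K -> operands v \subset C -> v <> a -> exists2 u, u \in C & u \in K.
Proof.
move=> /stepK [//|[u uv uK]] opC _; exists u => //.
by apply: (subsetP opC); rewrite inE.
Qed.

(** [bad] abstracts the event that the chunk computes [a]. A word of [K] in memory stems from a load
    of a word of [K], from the initial memory, or from [a]. Without [bad] and without such a load
    there is thus nothing of [K] to write, and under [bad] the chunk writes no word of [K] by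
    hypothesis. *)
Lemma silent_chunk (bad : Prop) C l : valid C l ->
  (forall v, v \in C -> v \in K -> bad) ->
  (a \in events as_comp l -> bad) ->
  (bad -> [disjoint events as_out l & K]) -> silent K l.
Proof.
elim: l C => [|[e C'] l IH] C //= [_ stp val] badC badA; rewrite !events_cons => badO.
have badA' : a \in events as_comp l -> bad.
  by move=> al; apply: badA; rewrite events_cons inE al orbT.
have badO' : bad -> [disjoint events as_out l & K].
  by move=> /badO; rewrite disjoint_setU => /andP [].
case: e stp badA badO => [sC'|w [_ opw sC']|w sC'|w [wC sC']] /= badA badO.
- by apply: IH val _ badA' badO' => v /(subsetP sC'); exact: badC.
- apply: IH val _ badA' badO' => v /(subsetP sC') /setU1P [->|]; last exact: badC.
  move=> wK; have [ew|/eqP nwa] := eqVneq w a.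
    by apply: badA; rewrite ew events_cons inE /= set11.
  by have [u uC uK] := comp_path wK opw nwa; exact: badC uK.
- move=> wK; apply: IH val _ badA' badO' => v /(subsetP sC') /setU1P [->|]; last exact: badC.
  by rewrite (negbTE wK).
- split; last by apply: IH val _ badA' badO' => v /(subsetP sC'); exact: badC.
  apply/negP => wK; have := badO (badC w wC wK).
  by rewrite disjoint_setU disjoints1 wK.
Qed.

(** The same origins of words of [K], now for the words computed by the chunk or present at its
    end. *)
Lemma final_chunk (bad : Prop) C l : valid C l ->
  (forall v, v \in C -> v \in K -> bad) ->
  (a \in events as_comp l -> bad) -> unread K l ->
  forall v, v \in K -> v \in final C l :|: events as_comp l -> bad.
Proof.
elim: l C => [|[e C'] l IH] C /=.
  by move=> _ badC _ _ v vK /setUP [/badC|]; [exact|rewrite inE].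
case=> _ stp val badC badA; rewrite /unread !events_cons disjoint_setU => /andP [un1 unl].
have badA' : a \in events as_comp l -> bad.
  by move=> al; apply: badA; rewrite events_cons inE al orbT.
have badComp w : e = Comp w -> w \in K -> bad.
  move=> ee wK; case: e ee stp badA {un1} => // w' [->] [_ opw _] badA.
  have [ew|/eqP nwa] := eqVneq w a.
    by apply: badA; rewrite ew events_cons inE /= set11.
  by have [u uC uK] := comp_path wK opw nwa; exact: badC uK.
have badC' v : v \in C' -> v \in K -> bad.
  case: e stp un1 badComp {badA} => [sC'|w [_ opw sC']|w sC'|w [wC sC']] /= un1 badComp.
  - by move=> /(subsetP sC'); exact: badC.
  - by move=> /(subsetP sC') /setU1P [->|]; [exact: badComp|exact: badC].
  - move=> /(subsetP sC') /setU1P [-> wK|]; last exact: badC.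
    by move: un1; rewrite disjoints1 wK.
  - by move=> /(subsetP sC'); exact: badC.
move=> v vK; rewrite setUCA => /setUP [|/(IH _ val badC' badA' unl v vK) //].
by case: e badComp {stp un1 badA} => [|w|w|w] badComp; rewrite /= !inE // => /eqP ev;
  apply: badComp (erefl _) _; rewrite -ev.
Qed.

End Path.

(** * Cutting a trace into chunks *)

Fixpoint marks C (ch : seq (seq item)) : seq ({set G} * seq item) :=
  if ch is l :: ch' then (C, l) :: marks (final C l) ch' else [::].

Lemma marks_valid C ch mk : valid C (flatten ch) -> #|C| <= M ->
  List.In mk (marks C ch) -> valid mk.1 mk.2 /\ #|mk.1| <= M.
Proof.
elim: ch C => [|l ch IH] C //= /valid_cat [vl vch] leC [<- /=|inmk].
  by [].
exact: IH vch (final_le leC vl) inmk.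
Qed.

Lemma marks_in C ch mk : List.In mk (marks C ch) -> List.In mk.2 ch.
Proof. by elim: ch C => //= l ch IH C [<-|/IH]; [left|right]. Qed.

Lemma marks_comp C ch v : v \in events as_comp (flatten ch) ->
  exists2 mk, List.In mk (marks C ch) & v \in events as_comp mk.2.
Proof.
elim: ch C => [|l ch IH] C /=; first by rewrite inE.
rewrite events_cat => /setUP [vl|/(IH (final C l)) [mk inmk vmk]].
  by exists (C, l) => //; left.
by exists mk => //; right.
Qed.

(** The criterion for assigning an elementary product [a] to a chunk, where [K] is the path from [a]
    to the root [r] of its summation tree. *)
Definition useful (K : {set G}) (a r : G) (mk : {set G} * seq item) : bool :=
  (a \in events as_comp mk.2) &&
  ((r \in events as_comp mk.2) ||
   ~~ [disjoint final mk.1 mk.2 :|: events as_out mk.2 & K]).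

(** Without a useful chunk, no word of [K] is carried over to a later chunk or written unless words
    of [K] have been read before. As every vertex of [K] other than [a] has an operand in [K], the
    root [r] could then be computed only in a chunk that computes [a], which would make that chunk
    useful. *)
Lemma useless_silent (K : {set G}) (a r : G) C ch :
  (forall v, v \in K -> v = a \/ exists2 u, edge u v & u \in K) -> r \in K ->
  valid C (flatten ch) -> [disjoint C & K] -> ~~ has (useful K a r) (marks C ch) ->
  silent K (flatten ch) /\
  (unread K (flatten ch) -> r \notin events as_comp (flatten ch)).
Proof.
move=> stepK rK; elim: ch C => [|l ch IH] C /=; first by rewrite inE.
move=> /valid_cat [vl vch] CK; rewrite negb_or => /andP [nu nus].
pose bad := a \in events as_comp l.
have badC v : v \in C -> v \in K -> bad.
  by move=> vC vK; move/pred0P: CK => /(_ v) /=; rewrite vC vK.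
have outK : bad -> [disjoint events as_out l & K].
  move=> ba; move: nu; rewrite /useful /= (ba : a \in events as_comp l) /= negb_or negbK => /andP [_].
  by rewrite disjoint_setU => /andP [].
have finK : unread K l -> [disjoint final C l & K].
  move=> un; apply/pred0P => v /=; apply/negP => /andP [vf vK].
  have ba : bad.
    by apply: (final_chunk stepK vl badC id un vK); rewrite inE vf.
  move: nu; rewrite /useful /= (ba : a \in events as_comp l) /= negb_or negbK => /andP [_].
  by rewrite disjoint_setU => /andP [/pred0P /(_ v) /=]; rewrite vf vK.
split.
  apply: silent_cat; first by apply: (silent_chunk stepK vl badC _ outK).
  by move=> un; have [] := IH _ vch (finK un) nus.
rewrite /unread !events_cat disjoint_setU => /andP [un unch].
rewrite inE negb_or; apply/andP; split; last first.
  by have [_ ->] := IH _ vch (finK un) nus.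
apply/negP => rl; have ba : bad.
  by apply: (final_chunk stepK vl badC id un rK); rewrite inE rl orbT.
by move: nu; rewrite /useful /= (ba : a \in events as_comp l) rl.
Qed.

Lemma split_ios l r : r <= ios l -> exists l1 l2, l = l1 ++ l2 /\ ios l1 = r.
Proof.
elim: l r => [|i l IH] r; first by rewrite leqn0 => /eqP ->; exists [::], [::].
case: r => [_|r]; first by exists [::], (i :: l).
have iosE l' : ios (i :: l') = as_in i + as_out i + ios l' by rewrite /ios /=; lia.
rewrite iosE => ler.
have le1 : as_in i + as_out i <= 1 by case: i {iosE ler} => -[].
have [l1 [l2 [-> e]]] := IH (r.+1 - (as_in i + as_out i)) ltac:(lia).
by exists (i :: l1), l2; split=> //; rewrite iosE e; lia.
Qed.

(** Chunks are cut off from the end. The incomplete one comes first, when the memory holds input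
    digits only and private words have to be loaded. *)
Lemma split_chunks l : 0 < M ->
  exists l0 ch, [/\ l = l0 ++ flatten ch,
    ios l0 < M & forall c, List.In c ch -> ios c = M].
Proof.
move=> M0; have [q] := ubnP (ios l); elim: q l => // q IH l ltq.
have [leM|ltM] := leqP M (ios l); last by exists l, [::]; rewrite cats0.
have [l1 [l2 [el e1]]] := @split_ios l (ios l - M) (leq_subr _ _).
have e2 : ios l2 = M by move: leM; rewrite el ios_cat in e1 *; lia.
have [|l0 [ch [e lt0 chM]]] := IH l1; first by lia.
exists l0, (rcons ch l2); split=> //; first by rewrite el e flatten_rcons catA.
by move=> c; rewrite -cats1 => /List.in_app_iff [/chM|[<-|[]]].
Qed.

End Traces.

(** * Counting over the chunks of a trace *)

(** Meaningful only if [a] is a leaf; a leaf that is not on the left is assumed to be on the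
    right. *)
Fixpoint tree_path (T : eqType) (t : sumtree T) (a : T) : seq T :=
  match t with
  | SLeaf v => [:: v]
  | SNode v _ l r => v :: (if a \in sleaves l then tree_path l a else tree_path r a)
  end.

Lemma tree_path_root (T : eqType) (t : sumtree T) a : sroot t \in tree_path t a.
Proof. by case: t => [v|v b l r]; rewrite /= mem_head. Qed.

Lemma tree_path_sub (T : eqType) (t : sumtree T) a v :
  a \in sleaves t -> v \in tree_path t a -> v = a \/ v \in sinner t.
Proof.
elim: t => [w|w b l IHl r IHr] /=; first by rewrite !inE => /eqP -> /eqP ->; left.
rewrite mem_cat inE => al /orP [/eqP ->|]; first by right; rewrite mem_head.
case: ifP al => [al _ /(IHl al)|_ /= ar /(IHr ar)] [->|vi]; rewrite ?inE ?mem_cat ?vi ?orbT;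
  by [left|right].
Qed.

Lemma tree_path_step s (G : cdag s) (t : sumtree G) a v :
  sumtree_ok t -> a \in sleaves t -> v \in tree_path t a ->
  v = a \/ exists2 u, edge u v & u \in tree_path t a.
Proof.
elim: t => [w|w b l IHl r IHr] /=; first by rewrite !inE => _ /eqP -> /eqP ->; left.
case=> eE _ okl okr; rewrite mem_cat => al; rewrite inE => /orP [/eqP ->|].
  right; case: ifP => _; [exists (sroot l)|exists (sroot r)];
    by rewrite ?eE ?eqxx ?orbT ?inE ?tree_path_root ?orbT.
case: ifP al => [al _ /(IHl okl al)|_ /= ar /(IHr okr ar)] [->|[u uv ul]]; [by left|right|by left|right];
  by exists u => //; rewrite inE ul orbT.
Qed.

Lemma leq_sum_In (T : Type) (r : seq T) (F1 F2 : T -> nat) :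
  (forall x, List.In x r -> F1 x <= F2 x) -> \sum_(x <- r) F1 x <= \sum_(x <- r) F2 x.
Proof.
elim: r => [|x r IH] le; rewrite ?big_nil // !big_cons leq_add ?le //; first by left.
by apply: IH => y yr; apply: le; right.
Qed.

Lemma leq_In_sum (T : Type) (r : seq T) (F : T -> nat) x :
  List.In x r -> F x <= \sum_(y <- r) F y.
Proof.
elim: r => //= y r IH [->|/IH le]; rewrite big_cons ?leq_addr //.
exact: leq_trans le (leq_addl _ _).
Qed.

Lemma has_In (T : Type) (r : seq T) (F : pred T) :
  has F r -> exists2 x, List.In x r & F x.
Proof.
elim: r => //= y r IH /orP [Fy|/IH [x xr Fx]]; first by exists y => //; left.
by exists x => //; right.
Qed.

Lemma card_value_set (T : finType) (m : nat) (A : {set T}) (g : T -> nat) :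
  #|[set c : 'I_m | [exists v in A, g v == c]]| <= #|A|.
Proof.
rewrite -(card_imset (f := @Some 'I_m) _ (@Some_inj _)).
apply: leq_trans (leq_imset_card (fun v => insub (g v) : option 'I_m) (mem A)).
apply/subset_leq_card/subsetP => x /imsetP [c]; rewrite inE => /exists_inP [v vA /eqP gv] ->.
by apply/imsetP; exists v => //; rewrite gv valK.
Qed.

(* Along an antidiagonal each coordinate determines the other one. *)
Lemma card_antidiagonals (F m : nat) (al be : {set 'I_F}) (act : {set 'I_m}) :
  #|[set xy : 'I_F * 'I_F | [&& xy.1 \in al, xy.2 \in be
     & [exists c in act, xy.1 + xy.2 == c :> nat]]]| <= minn #|al| #|be| * #|act|.
Proof.
set U := [set xy | _].
have coverU : U \subset \bigcup_(c in act)
    [set xy : 'I_F * 'I_F | [&& xy.1 \in al, xy.2 \in be & xy.1 + xy.2 == c :> nat]].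
  apply/subsetP => xy; rewrite inE => /and3P [xa yb /exists_inP [c cact e]].
  by apply/bigcupP; exists c => //; rewrite inE xa yb e.
apply: leq_trans (subset_leq_card coverU) _.
apply: leq_trans (_ : _ <= \sum_(c in act) minn #|al| #|be|) _; last first.
  by rewrite sum_nat_const mulnC.
elim/big_rec2: _ => [|c y V _ IH]; first by rewrite cards0.
apply: leq_trans (leq_card_setU _ _) (leq_add _ IH).
rewrite leq_min; apply/andP; split.
- rewrite -(card_in_imset (f := fst)); last first.
    move=> [x y1] [x' y2]; rewrite !inE /= => /and3P [_ _ /eqP e] /and3P [_ _ /eqP e'] ex.
    by subst x'; congr pair; apply: val_inj => /=; lia.
  by apply/subset_leq_card/subsetP => x /imsetP [xy]; rewrite inE => /andP [? _] ->.
- rewrite -(card_in_imset (f := snd)); last first.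
    move=> [x y1] [x' y2]; rewrite !inE /= => /and3P [_ _ /eqP e] /and3P [_ _ /eqP e'] ex.
    by subst y2; congr pair; apply: val_inj => /=; lia.
  by apply/subset_leq_card/subsetP => x /imsetP [xy]; rewrite inE => /and3P [_ ? _] ->.
Qed.

(* The windows [h, 2h) and [2h, 3h) of output positions. *)
Definition goodpairs (F : nat) : {set 'I_F * 'I_F} :=
  [set xy : 'I_F * 'I_F | F./2 <= xy.1 + xy.2 < 3 * F./2].

Lemma card_goodpairs F : 3 * F./2 ^ 2 + 2 * F./2 * odd F <= #|goodpairs F|.
Proof.
(* For fixed [x] the admissible [y] form an interval; truncated subtraction makes it start at 0 when
   [x] is at least [F./2]. *)
have colE (x : 'I_F) : minn F (3 * F./2 - x) - (F./2 - x) <=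
    #|[set y : 'I_F | F./2 <= x + y < 3 * F./2]|.
  set a := F./2 - x; set b := minn _ _ - a.
  have leF (y : 'I_b) : a + y < F by have := ltn_ord y; rewrite /b /a; lia.
  have inj : injective (fun y : 'I_b => Ordinal (leF y)).
    by move=> y y' /(congr1 val) /= /addnI; apply: val_inj.
  rewrite -[X in X <= _](card_ord b) -(card_image inj).
  apply/subset_leq_card/subsetP => z /imageP [y _ ->]; rewrite inE /=.
  by have := ltn_ord y; rewrite /b /a; lia.
have : \sum_(x < F) (minn F (3 * F./2 - x) - (F./2 - x)) <= #|goodpairs F|.
  apply: (@leq_trans (\sum_(x < F) #|[set y : 'I_F | F./2 <= x + y < 3 * F./2]|)).
    by apply: leq_sum => x _; exact: colE.
  under eq_bigr => x _ do rewrite -sum1_card.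
  rewrite -sum1_card (eq_bigl (fun xy : 'I_F * 'I_F => predT xy.1 && (F./2 <= xy.1 + xy.2 < 3 * F./2)));
    last by move=> xy; rewrite inE.
  rewrite -(pair_big_dep predT (fun x y : 'I_F => F./2 <= x + y < 3 * F./2) (fun _ _ => 1)) /=.
  by apply: leq_sum => x _; rewrite (eq_bigl _ _ (fun y => in_set _ y)).
apply: leq_trans.
set h := F./2.
have sumE : \sum_(x < F) (minn F (3 * h - x) - (h - x)) =
    \sum_(0 <= x < h) (minn F (3 * h - x) - (h - x)) +
    \sum_(h <= x < F) (minn F (3 * h - x) - (h - x)).
  by rewrite -big_cat_nat ?big_mkord //= /h; lia.
have E := odd_double_half F; rewrite sumE -/h in E *; clear sumE.
have -> : \sum_(h <= x < F) (minn F (3 * h - x) - (h - x)) =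
    \sum_(0 <= x < F - h) (2 * h - x).
  rewrite -{1}[h]add0n big_addn; apply: eq_big_nat => x; lia.
have -> : F - h = h + odd F by lia.
have -> : \sum_(0 <= x < h + odd F) (2 * h - x) = \sum_(0 <= x < h) (2 * h - x) + h * odd F.
  case: (odd F) => /=; last by rewrite !addn0 muln0 addn0.
  by rewrite addn1 big_nat_recr //=; lia.
(* The columns [x] and [h + x] together contribute [3 * h + odd F]; for odd [F] the remaining column
   [2 * h] contributes [h]. *)
rewrite addnA -big_split /=.
rewrite (eq_big_nat _ _ (F2 := fun _ => 3 * h + odd F)); last by move=> x; lia.
by rewrite sum_nat_const_nat; case: (odd F); nia.
Qed.

(* In these inequalities a chunk with R loads and W stores involves d private
   words and at least y words on each of the sides of A and B; e words survive
   it, and z, z0, z1 count the outputs in a window. *)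
Lemma full_outputs M y d R z : 0 < M -> z * (2 * M - y) <= 2 * M * d ->
  d + 2 * y <= M + R -> R <= M -> z <= 2 * M.
Proof.
move=> M0 le ledy leR; have u0 : 0 < 2 * M - y by lia.
rewrite -(leq_pmul2r u0); apply: leq_trans le _.
by rewrite leq_mul2l; apply/orP; right; lia.
Qed.

Lemma first_outputs M y d R z : 0 < M -> z * (2 * M - y) <= 2 * M * d ->
  y <= M -> d <= R -> z <= 2 * R.
Proof.
move=> M0 le ley led; have := leq_mul (leqnn z) (_ : M <= 2 * M - y) => /(_ ltac:(lia)).
nia.
Qed.

Local Open Scope Z_scope.

Lemma full_poly (M y d W u : Z) : 0 <= W -> 0 <= y <= M -> u = 2 * M - y ->
  d <= 2 * M - W - 2 * y ->
  y * (M + W) * u + 4 * M * y * d <= 2 * M * M * u.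
Proof.
intros W0 y0 -> led.
(* For the largest admissible d the right-hand side exceeds the left-hand side by exactly M (2M -
   3y)^2 + W (2My + y^2). *)
assert (0 <= M * ((2 * M - 3 * y) * (2 * M - 3 * y))) by
  (apply Z.mul_nonneg_nonneg; [lia|apply Z.square_nonneg]).
assert (0 <= W * (2 * M * y + y * y)) by (apply Z.mul_nonneg_nonneg; nia).
assert (4 * M * y * d <= 4 * M * y * (2 * M - W - 2 * y)) by (apply Z.mul_le_mono_nonneg_l; nia).
lia.
Qed.

Lemma first_poly (M y d R u : Z) : 0 <= d <= R -> R <= M -> 0 <= y <= M -> u = 2 * M - y ->
  d + 2 * y <= M + R ->
  8 * M * y * d <= 5 * M * R * u.
Proof.
intros d0 RM y0 -> le.
assert (8 * y * d <= 5 * R * (2 * M - y)).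
(* The condition means 8y <= 5(2M - y), in which case d <= R suffices. Otherwise R >= d + 2y - M is
   used, together with d <= 2M - 2y. *)
{ destruct (Z.le_gt_cases (13 * y) (10 * M)).
  { assert (d * (8 * y) <= d * (5 * (2 * M - y))) by (apply Z.mul_le_mono_nonneg_l; lia).
    assert (d * (5 * (2 * M - y)) <= R * (5 * (2 * M - y))) by (apply Z.mul_le_mono_nonneg_r; lia).
    lia. }
  assert (d * (13 * y - 10 * M) <= (2 * M - 2 * y) * (13 * y - 10 * M))
    by (apply Z.mul_le_mono_nonneg_r; lia).
  assert ((d + 2 * y - M) * (5 * (2 * M - y)) <= R * (5 * (2 * M - y))) by (apply Z.mul_le_mono_nonneg_r; lia).
  nia. }
assert (M * (8 * y * d) <= M * (5 * R * (2 * M - y))) by (apply Z.mul_le_mono_nonneg_l; lia).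
lia.
Qed.

Lemma first_poly' (M y d R u : Z) : 0 <= d <= R -> R <= M -> 0 <= y <= M -> u = 2 * M - y ->
  d + 2 * y <= M + R ->
  2 * y * M * u + 8 * M * y * d <= (M * M + 5 * M * R) * u.
Proof.
intros d0 RM y0 -> le.
assert (2 * y * (2 * M - y) + 8 * y * d <= (M + 5 * R) * (2 * M - y)).
(* For 2y <= M the two summands are bounded separately, by M(2M - y) and by 5R(2M - y). Otherwise R
   is replaced by its lower bound d + 2y - M. *)
{ destruct (Z.le_gt_cases (2 * y) M).
  { assert (2 * y * (2 * M - y) <= M * (2 * M - y)) by (apply Z.mul_le_mono_nonneg_r; lia).
    assert (d * (8 * y) <= d * (5 * (2 * M - y))) by (apply Z.mul_le_mono_nonneg_l; lia).
    assert (d * (5 * (2 * M - y)) <= R * (5 * (2 * M - y))) by (apply Z.mul_le_mono_nonneg_r; lia).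
    lia. }
  assert (d * (13 * y - 10 * M) <= (8 * y - 4 * M) * (2 * M - y)).
  { destruct (Z.le_gt_cases (13 * y) (10 * M)).
    { assert (0 <= (8 * y - 4 * M) * (2 * M - y)) by (apply Z.mul_nonneg_nonneg; lia).
      assert (0 <= d * (10 * M - 13 * y)) by (apply Z.mul_nonneg_nonneg; lia). lia. }
    assert (d * (13 * y - 10 * M) <= (2 * M - 2 * y) * (13 * y - 10 * M))
      by (apply Z.mul_le_mono_nonneg_r; lia).
    nia. }
  assert ((d + 2 * y - M) * (5 * (2 * M - y)) <= R * (5 * (2 * M - y))) by (apply Z.mul_le_mono_nonneg_r; lia).
  lia. }
assert (M * (2 * y * (2 * M - y) + 8 * y * d) <= M * ((M + 5 * R) * (2 * M - y))) by (apply Z.mul_le_mono_nonneg_l; lia).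
lia.
Qed.

(** Multiplication by u clears the denominator of the bounds 2Md/u on z0 and z1, so that a
    polynomial inequality remains. *)
Lemma scaled_products (M y d u e z0 z1 b : Z) : 0 < u -> 0 <= y ->
  z0 * u <= 2 * M * d -> z1 * u <= 2 * M * d ->
  y * e * u + 4 * M * y * d <= b * u -> y * (e + z0 + z1) <= b.
Proof.
intros u0 y0 le0 le1 le.
apply Z.mul_le_mono_pos_r with u; [lia|].
assert (y * (z0 * u) <= y * (2 * M * d)) by (apply Z.mul_le_mono_nonneg_l; lia).
assert (y * (z1 * u) <= y * (2 * M * d)) by (apply Z.mul_le_mono_nonneg_l; lia).
lia.
Qed.

Section Products.

Variables M y d R W e z0 z1 u : Z.
Hypotheses (M0 : 0 < M) (y0 : 0 <= y) (d0 : 0 <= d) (R0 : 0 <= R) (W0 : 0 <= W).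
Hypotheses (e0 : 0 <= e) (eu : u = 2 * M - y).
Hypotheses (le0 : z0 * u <= 2 * M * d) (le1 : z1 * u <= 2 * M * d).
Hypotheses (le_dy : d + 2 * y <= M + R) (le_RW : R + W <= M).

Let u0 : 0 < u. Proof. lia. Qed.

Lemma full_productsZ : R + W = M -> e <= M + W -> y * (e + z0 + z1) <= 2 * M * M.
Proof.
intros eRW lee; apply scaled_products with (M := M) (d := d) (u := u); try lia.
assert (y * e * u <= y * (M + W) * u)
  by (apply Z.mul_le_mono_nonneg_r; [lia|apply Z.mul_le_mono_nonneg_l; lia]).
assert (poly := @full_poly M y d W u W0 ltac:(lia) eu ltac:(lia)); lia.
Qed.

Lemma first_productsZ : d <= R -> e <= M + W ->
  2 * y * (e + z0 + z1) <= M * M + 5 * M * (R + W).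
Proof.
intros led lee; apply scaled_products with (M := M) (d := d) (u := u); try lia.
assert (y * e * u <= y * (M + W) * u)
  by (apply Z.mul_le_mono_nonneg_r; [lia|apply Z.mul_le_mono_nonneg_l; lia]).
assert (2 * y * W <= 5 * M * W) by (apply Z.mul_le_mono_nonneg_r; lia).
assert (2 * y * W * u <= 5 * M * W * u) by (apply Z.mul_le_mono_nonneg_r; lia).
assert (poly := @first_poly' M y d R u ltac:(lia) ltac:(lia) ltac:(lia) eu ltac:(lia)); lia.
Qed.

(** For a trace without full chunks: nothing is left in memory at its end, so only the W stored
    words survive. *)
Lemma only_productsZ : d <= R -> e <= W -> 2 * y * (e + z0 + z1) <= 5 * M * (R + W).
Proof.
intros led lee; apply scaled_products with (M := M) (d := d) (u := u); try lia.
assert (2 * y * e <= 5 * M * W) by (apply Z.mul_le_mono_nonneg; lia).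
assert (2 * y * e * u <= 5 * M * W * u) by (apply Z.mul_le_mono_nonneg_r; lia).
assert (poly := @first_poly M y d R u ltac:(lia) ltac:(lia) ltac:(lia) eu ltac:(lia)); lia.
Qed.

End Products.

Local Close Scope Z_scope.

Section ProductsNat.

Variables M y d R W e z0 z1 : nat.
Hypothesis M0 : 0 < M.
Hypothesis le0 : z0 * (2 * M - y) <= 2 * M * d.
Hypothesis le1 : z1 * (2 * M - y) <= 2 * M * d.
Hypothesis le_dy : d + 2 * y <= M + R.
Hypothesis le_RW : R + W <= M.

Lemma full_products : R + W = M -> e <= M + W -> y * (e + z0 + z1) <= 2 * M * M.
Proof.
move=> eRW lee; move: le0 le1; set u := 2 * M - y; have eu : u + y = 2 * M by lia.
move=> le0' le1'; have := @full_productsZ (Z.of_nat M) (Z.of_nat y) (Z.of_nat d)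
  (Z.of_nat R) (Z.of_nat W) (Z.of_nat e) (Z.of_nat z0) (Z.of_nat z1) (Z.of_nat u).
lia.
Qed.

Lemma first_products : d <= R -> e <= M + W ->
  2 * (y * (e + z0 + z1)) <= M * M + 5 * M * (R + W).
Proof.
move=> led lee; move: le0 le1; set u := 2 * M - y; have eu : u + y = 2 * M by lia.
move=> le0' le1'; have := @first_productsZ (Z.of_nat M) (Z.of_nat y) (Z.of_nat d)
  (Z.of_nat R) (Z.of_nat W) (Z.of_nat e) (Z.of_nat z0) (Z.of_nat z1) (Z.of_nat u).
lia.
Qed.

Lemma only_products : d <= R -> e <= W -> 2 * (y * (e + z0 + z1)) <= 5 * M * (R + W).
Proof.
move=> led lee; move: le0 le1; set u := 2 * M - y; have eu : u + y = 2 * M by lia.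
move=> le0' le1'; have := @only_productsZ (Z.of_nat M) (Z.of_nat y) (Z.of_nat d)
  (Z.of_nat R) (Z.of_nat W) (Z.of_nat e) (Z.of_nat z0) (Z.of_nat z1) (Z.of_nat u).
lia.
Qed.

End ProductsNat.

Lemma leq_card_disjointU (T : finType) (D A B : {set T}) :
  [disjoint A & B] -> #|D :&: A| + #|D :&: B| <= #|D :&: (A :|: B)|.
Proof.
move=> dAB; rewrite setIUr -cardsUI setIACA setIid.
by rewrite (disjoint_setI0 dAB) setI0 cards0 addn0.
Qed.

(** * Outputs and elementary products of all maximal sub-problems *)

Section Family.

Variables (s : nat) (G : cdag s) (n : nat) (S : site G n) (t : instr n) (M : nat).
Variables (I : finType) (N : I -> node G) (KA KB : {set G}).
Hypotheses (s1 : 1 < s) (M0 : 0 < M) (okS : site_ok S).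
Hypothesis dec : decomposed (ins S) S t (8 * M) N KA KB.

Let X := ins S.
Let uS := site_in_uniq okS.
Let sdA := sideA S KA.
Let sdB := sideB S KB.
Let bd i := body (nsite (N i)).
Let h i := (uphalf (nsize (N i)))./2.

Implicit Type mk : {set G} * seq (item G).

Definition loads mk : {set G} := mk.1 :|: events (@as_in s G) mk.2.
Definition seen mk : {set G} := loads mk :|: events (@as_comp s G) mk.2.
Definition leftover mk : {set G} := final mk.1 mk.2 :|: events (@as_out s G) mk.2.
(** The quantity y of the inequalities for one chunk. *)
Definition common mk : nat := minn #|loads mk :&: sdA| #|loads mk :&: sdB|.
(** [b] = 0 and [b] = 1 select the windows [h, 2h) and [2h, 3h). *)
Definition win i b mk := window N i (seen mk) (b * h i + h i) (h i).
Definition private mk : nat := \sum_i #|loads mk :&: bd i|.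
Definition wins b mk : nat := \sum_i #|win i b mk|.

Lemma sides_card (D : {set G}) : \sum_i #|D :&: bd i| + #|D :&: sdA| + #|D :&: sdB| <= #|D|.
Proof.
have leA : #|D :&: sdA| <= #|D :&: KA| + #|D :&: [set v in inA S]|.
  by rewrite /sdA /sideA setIUr leq_card_setU.
have leB : #|D :&: sdB| <= #|D :&: KB| + #|D :&: [set v in inB S]|.
  by rewrite /sdB /sideB setIUr leq_card_setU.
have leX : #|D :&: [set v in inA S]| + #|D :&: [set v in inB S]| <= #|D :&: X|.
  apply: leq_trans (leq_card_disjointU _ _) _.
    apply/pred0P => v /=; rewrite !inE; apply/negP => /andP [vA vB].
    by move: uS; rewrite cat_uniq => /and3P [_ /hasPn /(_ v vB)]; rewrite /= vA.
  by apply/subset_leq_card/setIS/subsetP => v; rewrite !inE mem_cat.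
have leD : #|D :&: body S| + #|D :&: X| <= #|D|.
  apply: leq_trans (leq_card_disjointU _ _) (subset_leq_card (subsetIl _ _)).
  by rewrite disjoint_sym; exact: site_disjoint.
have arith z a b a' b' a1 b1 c x d : z + a + b <= c -> a' <= a + a1 -> b' <= b + b1 ->
  a1 + b1 <= x -> c + x <= d -> z + a' + b' <= d by lia.
exact: arith (dec_card dec D) leA leB leX leD.
Qed.

(** The reason for the threshold 8M: halving twice still leaves windows of at least 2M positions,
    twice what the smaller side can hold in a chunk. *)
Lemma h_ge i : 2 * M <= h i.
Proof. by have /andP [le _] := dec_size dec i; rewrite /h; lia. Qed.

Lemma win_bound i b mk : valid X M mk.1 mk.2 -> b <= 1 ->
  #|win i b mk| * (h i - common mk) <= h i * #|loads mk :&: bd i|.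
Proof.
move=> /valid_supported [sup _ _] b1; have h2 := h_ge i.
by apply: (window_bound s1 okS dec sup); rewrite ?/h; move: h2; rewrite /h; nia.
Qed.

Lemma private_common mk :
  #|mk.1| <= M -> private mk + 2 * common mk <= M + count (fun i => as_in i) mk.2.
Proof.
move=> le1; have := sides_card (loads mk).
have : #|loads mk| <= M + count (fun i => as_in i) mk.2.
  by apply: leq_trans (leq_card_setU _ _) (leq_add le1 (card_events _ _)).
have arith z a b y d c : y <= a -> y <= b -> d <= c -> z + a + b <= d -> z + 2 * y <= c by lia.
by apply: arith; rewrite /common ?geq_minl ?geq_minr.
Qed.

Lemma private_first mk : mk.1 \subset X -> private mk <= count (fun i => as_in i) mk.2.
Proof.
move=> sX; apply: leq_trans (card_events _ _).
have := sides_card (events (@as_in s G) mk.2); rewrite -addnA => /(leq_trans (leq_addr _ _)).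
apply: leq_trans; apply: leq_sum => i _; apply/subset_leq_card/subsetP => v.
rewrite in_setI => /andP [/setUP [v1|vE] vi]; rewrite in_setI vi ?vE //.
have vS := subsetP (dec_sub dec i) v vi.
by have := body_notin_ins okS vS; rewrite (subsetP sX v v1).
Qed.

Lemma wins_bound b mk : valid X M mk.1 mk.2 -> b <= 1 -> common mk <= M ->
  wins b mk * (2 * M - common mk) <= 2 * M * private mk.
Proof.
move=> val b1 leY; rewrite /wins /private big_distrl big_distrr /=.
apply: leq_sum => i _; have := win_bound i val b1; have := h_ge i.
move: #|win i b mk| #|_ :&: bd i| (h i) (common mk) leY => w d k y leY k2 le.
(* For w > d the window bound reads k (w - d) <= w y, which persists when k decreases to 2M. The
   nodes thus get a common factor and can be added up. *)
have [lewd|ltdw] := leqP w d; first by nia.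
have e : w * y + (2 * M) * (w - d) <= w * y + k * (w - d) by nia.
nia.
Qed.

Variables (P : nat) (L : 'I_P -> seq (item G)) (C0 : 'I_P -> {set G}).
Variable ch : 'I_P -> seq (seq (item G)).
Hypothesis validL : forall p, valid X M (C0 p) (L p).
Hypothesis C0X : forall p, C0 p \subset X.
Hypothesis C0M : forall p, #|C0 p| <= M.
Hypothesis coverL : forall v, v \notin X -> exists p, v \in events (@as_comp s G) (L p).
(** Causality between the processors: a word that is not an input must be written before it can be
    read, so a set which nobody writes first is never read. *)
Hypothesis provL : forall K : {set G}, [disjoint X & K] -> (forall p, silent K (L p)) ->
  forall p, unread K (L p).
Hypothesis chE : forall p, flatten (ch p) = L p.

Definition mks p := marks (C0 p) (ch p).

Lemma mks_valid p mk : List.In mk (mks p) ->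
  valid X M mk.1 mk.2 /\ #|mk.1| <= M.
Proof. by apply: marks_valid; rewrite ?chE. Qed.

Lemma mks_comp v : v \notin X ->
  exists p, exists2 mk, List.In mk (mks p) & v \in events (@as_comp s G) mk.2.
Proof.
move=> /coverL [p]; rewrite -chE => /(marks_comp (C0 p)) [mk inmk vmk].
by exists p, mk.
Qed.

Lemma sum_cover (T : finType) (A : {set T}) (U : {set G} * seq (item G) -> {set T}) :
  (forall x, x \in A -> exists p, exists2 mk, List.In mk (mks p) & x \in U mk) ->
  #|A| <= \sum_p \sum_(mk <- mks p) #|U mk|.
Proof.
move=> cov.
have -> : \sum_p \sum_(mk <- mks p) #|U mk| =
    \sum_(x : T) \sum_p \sum_(mk <- mks p) (x \in U mk).
  rewrite exchange_big; apply: eq_bigr => p _; rewrite exchange_big.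
  by apply: eq_bigr => mk _; rewrite -sum1_card big_mkcond; apply: eq_bigr => x _; case: ifP.
rewrite -sum1_card big_mkcond; apply: leq_sum => x _; case: ifP => // /cov [p [mk inmk xU]].
rewrite (bigD1 p) //=; apply: leq_trans (leq_addr _ _).
by have := leq_In_sum (fun mk => x \in U mk : nat) inmk; rewrite /= xU.
Qed.

Lemma out_body i c : tnth (outC (nsite (N i))) c \in bd i.
Proof. by apply: (site_out_body (dec_ok dec i).1); rewrite mem_tnth. Qed.

Lemma bd_notin i v : v \in bd i -> v \notin X.
Proof. by move=> /(subsetP (dec_sub dec i)); exact: body_notin_ins. Qed.

Lemma comp_seen mk v : v \in events (@as_comp s G) mk.2 -> v \in seen mk.
Proof. by move=> vm; rewrite /seen inE vm orbT. Qed.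

Lemma node_outputs i : 2 * M <= \sum_p \sum_(mk <- mks p) #|win i 0 mk|.
Proof.
set m := nsize (N i).
have lt_m (z : 'I_(h i)) : h i + z < m + m by have := ltn_ord z; rewrite /h -/m; lia.
pose A := [set Ordinal (lt_m z) | z in 'I_(h i)].
have cA : #|A| = h i.
  rewrite card_imset ?card_ord // => z z' /(congr1 val) /= /addnI.
  exact: val_inj.
apply: leq_trans (h_ge i) _; rewrite -cA; apply: sum_cover => c /imsetP [z _ ec].
have [p [mk inmk cmk]] := mks_comp (bd_notin (out_body c)).
exists p, mk => //; rewrite inE comp_seen // andbT ec /=.
by have := ltn_ord z; lia.
Qed.

(** Every good pair is assigned to a useful chunk. Within one chunk, the assigned pairs have both
    digits known and lie on active antidiagonals, so [card_antidiagonals] bounds their number. *)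
Lemma node_products i : nstd (N i) ->
  #|goodpairs (uphalf (nsize (N i)))| <=
  \sum_p \sum_(mk <- mks p)
    common mk * (#|leftover mk :&: bd i| + #|win i 0 mk| + #|win i 1 mk|).
Proof.
move=> /(dec_std dec) [mul [tree [rl std]]].
set m := nsize (N i) in mul tree std *; set F := uphalf m.
pose wd (x : 'I_F) : 'I_m := widen_ord (uphalf_le m) x.
have lt_c (xy : 'I_F * 'I_F) : xy.1 + xy.2 < m + m.
  by have := ltn_ord xy.1; have := ltn_ord xy.2; rewrite /F; lia.
pose cc xy := Ordinal (lt_c xy).
pose a (xy : 'I_F * 'I_F) := mul (wd xy.1) (wd xy.2).
pose K xy : {set G} := [set v in tree_path (tree (cc xy)) (a xy)].
pose rt xy := tnth (outC (nsite (N i))) (cc xy).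
pose U mk := [set xy in goodpairs F | useful (K xy) (a xy) (rt xy) mk].
have a_leaf xy : a xy \in sleaves (tree (cc xy)) by apply: (std_tree_products std).
have K_role xy v : v \in K xy -> v \in bd i /\ position (rl v) = xy.1 + xy.2.
  rewrite inE => /(tree_path_sub (a_leaf xy)) [->|].
    by rewrite (std_mul_role std); split=> //; exact: (std_mul_body std).
  by move=> /(std_tree_inner std) [vb ->].
have rootK xy : rt xy \in K xy by rewrite inE /rt -(std_tree_root std) tree_path_root.
apply: (@leq_trans (\sum_p \sum_(mk <- mks p) #|U mk|)).
  apply: sum_cover => xy xyg.
  have [p /has_In [mk inmk umk]|none] := pickP (fun p => has (useful (K xy) (a xy) (rt xy)) (mks p)).
    by exists p, mk => //; rewrite inE xyg.
  (* With no useful chunk anywhere, the path would be silent in all traces, hence never read, and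
     its root never computed. *)
  exfalso.
  have dX : [disjoint X & K xy].
    apply/pred0P => v /=; apply/negP => /andP [vX /K_role [vb _]].
    by have := bd_notin vb; rewrite vX.
  have res p : silent (K xy) (L p) /\
      (unread (K xy) (L p) -> rt xy \notin events (@as_comp s G) (L p)).
    rewrite -chE; apply: (@useless_silent _ _ X M _ (a xy) _ (C0 p)) => //.
    - move=> v; rewrite inE => vK.
      have [->|[u uv uK]] := tree_path_step (std_tree_ok std _) (a_leaf xy) vK; first by left.
      by right; exists u => //; rewrite inE.
    - by rewrite chE.
    - exact: disjointWl (C0X p) dX.
    - by rewrite none.
  have un := provL dX (fun p => (res p).1).
  have [p] := coverL (bd_notin (K_role xy _ (rootK xy)).1).
  by apply/negP; exact: (res p).2.
apply: leq_sum => p _; apply: leq_sum_In => mk /mks_valid [val _].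
have [sup finT opT] := valid_supported val.
pose act := [set c : 'I_(m + m) | [exists v in leftover mk :&: bd i, position (rl v) == c]]
  :|: win i 0 mk :|: win i 1 mk.
pose al := knownA N i (seen mk); pose be := knownB N i (seen mk).
apply: (@leq_trans (minn #|al| #|be| * #|act|)); last first.
  rewrite leq_mul //.
    rewrite /common leq_min; apply/andP; split.
      exact: leq_trans (geq_minl _ _) (knownA_bound s1 okS dec i sup).
    exact: leq_trans (geq_minr _ _) (knownB_bound s1 okS dec i sup).
  apply: leq_trans (leq_card_setU _ _) _; rewrite leq_add2r.
  apply: leq_trans (leq_card_setU _ _) _; rewrite leq_add2r.
  exact: card_value_set.
apply: leq_trans (card_antidiagonals al be act); apply/subset_leq_card/subsetP => xy.
rewrite inE => /andP [xyg /andP [acomp rest]].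
have opS u : edge u (a xy) -> u \in seen mk by exact: opT acomp.
rewrite in_set; apply/and3P; split.
- by rewrite in_set; apply: opS; rewrite (std_mul_edge std); rewrite eqxx.
- by rewrite in_set; apply: opS; rewrite (std_mul_edge std); rewrite eqxx orbT.
apply/exists_inP; exists (cc xy) => //.
(* A computed root lies in one of the two windows because the pair is good; a surviving vertex of
   the path carries the position of the pair in its role. *)
case/orP: rest => [rc|/pred0Pn [v /andP [vE vK]]].
  have /andP [c1 c2] : h i <= xy.1 + xy.2 < 3 * h i by move: xyg; rewrite in_set.
  have memw b : b * h i + h i <= xy.1 + xy.2 < b * h i + h i + h i -> cc xy \in win i b mk.
    by move=> cb; rewrite in_set cb; exact: comp_seen rc.
  have [lt2|ge2] := ltnP (xy.1 + xy.2) (2 * h i).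
    by apply/setUP; left; apply/setUP; right; apply: memw; move: c1 c2; lia.
  by apply/setUP; right; apply: memw; move: c1 c2; lia.
have [vb pv] := K_role xy v vK.
apply/setUP; left; apply/setUP; left; rewrite inE.
by apply/exists_inP; exists v; rewrite ?pv //; apply/setIP; split.
Qed.

Hypothesis finalL : forall p, final (C0 p) (L p) = set0.
Hypothesis chP : forall p, exists c0 cs,
  [/\ ch p = c0 :: cs, ios c0 < M & forall c, List.In c cs -> ios c = M].

Let R mk := count (fun i => as_in i : bool) mk.2.
Let W mk := count (fun i => as_out i : bool) mk.2.
Let use mk := common mk * (#|leftover mk| + wins 0 mk + wins 1 mk).

Lemma common_le mk : #|mk.1| <= M -> ios mk.2 <= M -> common mk <= M.
Proof. by move=> /private_common le1; rewrite /ios => le2; lia. Qed.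

Lemma leftover_le mk : valid X M mk.1 mk.2 -> #|mk.1| <= M -> #|leftover mk| <= M + W mk.
Proof.
move=> val le1; apply: leq_trans (leq_card_setU _ _) (leq_add _ (card_events _ _)).
exact: final_le val.
Qed.

Lemma sum_marks (F : {set G} * seq (item G) -> nat) C cs b :
  (forall mk, List.In mk (marks C cs) -> F mk <= b) ->
  \sum_(mk <- marks C cs) F mk <= size cs * b.
Proof.
elim: cs C => [|c cs IH] C le; first by rewrite big_nil.
rewrite big_cons /= mulSn leq_add //; first by apply: le; left.
by apply: IH => mk inmk; apply: le; right.
Qed.

Lemma ios_flatten (cs : seq (seq (item G))) : (forall c, List.In c cs -> ios c = M) ->
  ios (flatten cs) = size cs * M.
Proof.
elim: cs => //= c cs IH le; rewrite ios_cat IH => [|c' inc]; last by apply: le; right.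
by rewrite le ?mulSn //; left.
Qed.

Lemma proc_outputs p : \sum_(mk <- mks p) wins 0 mk <= 2 * ios (L p).
Proof.
have inmks mk := @mks_valid p mk; have [c0 [cs [ech lt0 fullcs]]] := chP p.
rewrite -chE ech /= ios_cat ios_flatten // mulnDr.
rewrite /mks ech /= in inmks *; rewrite big_cons leq_add //.
  have [val le1] := inmks _ (or_introl erefl).
  have leY : common (C0 p, c0) <= M by apply: common_le => //; exact: ltnW.
  have := first_outputs M0 (wins_bound val (leq0n 1) leY) leY (@private_first (_, _) (C0X p)).
  by rewrite /ios /=; lia.
rewrite mulnCA; apply: sum_marks => mk inmk.
have [val le1] := inmks mk (or_intror inmk).
have full := fullcs _ (marks_in inmk).
have leY : common mk <= M by apply: common_le; rewrite ?full.
apply: full_outputs M0 (wins_bound val (leq0n 1) leY) (private_common le1) _.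
by rewrite -full /ios leq_addr.
Qed.

Lemma use_full mk : valid X M mk.1 mk.2 -> #|mk.1| <= M -> ios mk.2 = M ->
  use mk <= 2 * M * M.
Proof.
move=> val le1 full; have leY : common mk <= M by apply: common_le; rewrite ?full.
apply: (full_products M0 (wins_bound val (leq0n 1) leY) (wins_bound val (leqnn 1) leY)
  (private_common le1) _ full (leftover_le val le1)).
by rewrite -full.
Qed.

(** Each full chunk uses at most 2M^2 of its share 5/2 M^2, and one remainder M^2/2 pays for the
    surplus of the first chunk. Without full chunks there is no surplus, as the final memory is
    empty. *)
Lemma proc_products p : 2 * \sum_(mk <- mks p) use mk <= 5 * M * ios (L p).
Proof.
have inmks mk := @mks_valid p mk; have [c0 [cs [ech lt0 fullcs]]] := chP p.
have finE := finalL p; move: finE.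
rewrite -chE ech /= ios_cat ios_flatten // => finE.
rewrite /mks ech /= in inmks *; rewrite big_cons mulnDr.
have [val le1] := inmks _ (or_introl erefl).
have leY : common (C0 p, c0) <= M by apply: common_le => //; exact: ltnW.
have w0 := wins_bound val (leq0n 1) leY; have w1 := wins_bound val (leqnn 1) leY.
case: cs => [|c1 cs] in ech fullcs inmks finE *.
  have leW : #|leftover (C0 p, c0)| <= W (C0 p, c0).
    move: finE; rewrite /leftover /= cats0 => ->; rewrite set0U; exact: card_events.
  have := only_products M0 w0 w1 (private_common le1) (ltnW lt0) (@private_first (_, _) (C0X p)) leW.
  by rewrite big_nil muln0 !addn0.
have lefirst := first_products M0 w0 w1 (private_common le1) (ltnW lt0) (@private_first (_, _) (C0X p))
  (leftover_le val le1).
have lerest : \sum_(mk <- marks (final (C0 p) c0) (c1 :: cs)) use mk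
    <= size (c1 :: cs) * (2 * M * M).
  apply: sum_marks => mk inmk; have [valk le1k] := inmks mk (or_intror inmk).
  exact: use_full valk le1k (fullcs _ (marks_in inmk)).
move: lefirst lerest; rewrite -/(use _) /ios /=.
set k := (size cs).+1; set x := use _; set y := \sum_(_ <- _) _ => lefirst lerest.
have kM : M * M <= k * (M * M) by rewrite leq_pmull.
by move: lefirst lerest; rewrite /R /W /=; nia.
Qed.

Lemma total_outputs : #|I| * M <= \sum_p ios (L p).
Proof.
rewrite -(leq_pmul2l (isT : 0 < 2)) big_distrr /=.
have : \sum_p \sum_(mk <- mks p) wins 0 mk <= \sum_p 2 * ios (L p).
  by apply: leq_sum => p _; exact: proc_outputs.
apply: leq_trans.
rewrite (eq_bigr (fun p => \sum_i \sum_(mk <- mks p) #|win i 0 mk|)); last first.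
  by move=> p _; rewrite exchange_big.
rewrite exchange_big /= mulnCA -sum_nat_const.
by apply: leq_sum => i _; exact: node_outputs.
Qed.

(** With F = 2k + o for o = 0 or 1, there are at least 3k^2 + 2ko good pairs, while the size is at
    most 2F. For odd F the inequality needs k >= 2, which [h_ge] provides. *)
Lemma size_goodpairs i : 5 * nsize (N i) ^ 2 <= 32 * #|goodpairs (uphalf (nsize (N i)))|.
Proof.
have := card_goodpairs (uphalf (nsize (N i))); have := h_ge i.
rewrite -/(h i); set k := h i; set F := uphalf _; set g := #|_|.
have EF : F = odd F + k.*2 by rewrite /k odd_double_half.
have leF : nsize (N i) <= F.*2 by rewrite /F; lia.
move: leF EF; move: (nsize (N i)) => m; case: (odd F) => leF EF k2 lg; nia.
Qed.

Lemma total_products : \sum_(i | nstd (N i)) nsize (N i) ^ 2 <= 16 * M * \sum_p ios (L p).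
Proof.
have le1 : \sum_(i | nstd (N i)) #|goodpairs (uphalf (nsize (N i)))| <=
    \sum_p \sum_(mk <- mks p) use mk.
  apply: leq_trans (_ : _ <= \sum_(i | nstd (N i)) \sum_p \sum_(mk <- mks p)
    common mk * (#|leftover mk :&: bd i| + #|win i 0 mk| + #|win i 1 mk|)) _.
    by apply: leq_sum => i; exact: node_products.
  apply: leq_trans (_ : _ <= \sum_i \sum_p \sum_(mk <- mks p)
    common mk * (#|leftover mk :&: bd i| + #|win i 0 mk| + #|win i 1 mk|)) _.
    by rewrite [X in X <= _]big_mkcond; apply: leq_sum => i _; case: ifP.
  rewrite exchange_big; apply: leq_sum => p _; rewrite exchange_big.
  apply: leq_sum => mk _; rewrite -big_distrr leq_mul2l !big_split /=; apply/orP; right.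
  rewrite !leq_add2r; have := sides_card (leftover mk).
  by rewrite -addnA; apply: leq_trans (leq_addr _ _).
have le2 : \sum_p 2 * \sum_(mk <- mks p) use mk <= \sum_p 5 * M * ios (L p).
  by apply: leq_sum => p _; exact: proc_products.
have le3 : \sum_(i | nstd (N i)) 5 * nsize (N i) ^ 2 <=
    \sum_(i | nstd (N i)) 32 * #|goodpairs (uphalf (nsize (N i)))|.
  by apply: leq_sum => i _; exact: size_goodpairs.
(* 32/5 pairs per unit of squared size and 5/2 M pairs per word transferred combine to the factor
   16M. *)
move: le1 le2 le3; rewrite -!big_distrr /=; nia.
Qed.

End Family.

(** * The two machine models *)

Section Items.

Variables (s : nat) (G : cdag s) (X : {set G}) (M : nat).
Implicit Types (l : seq (item G)) (C : {set G}) (ws : seq G).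

Lemma silent_catl (K : {set G}) l1 l2 : silent K (l1 ++ l2) -> silent K l1.
Proof.
elim: l1 => [|[[|v|v|v] C] l1 IH] //= sl; try exact: IH.
  by move=> vK; apply: IH; apply: sl.
by case: sl => vK /IH.
Qed.

Lemma silent_catr (K : {set G}) l1 l2 :
  silent K (l1 ++ l2) -> unread K l1 -> silent K l2.
Proof.
rewrite /unread; elim: l1 => [|[[|v|v|v] C] l1 IH] //= sl;
  rewrite events_cons disjoint_setU => /andP [un1 un]; try exact: IH un.
  by apply: IH un; apply: sl; rewrite -disjoints1.
by case: sl => _ /IH; apply.
Qed.

Lemma unread_cat (K : {set G}) l1 l2 :
  unread K (l1 ++ l2) <-> unread K l1 /\ unread K l2.
Proof. by rewrite /unread events_cat disjoint_setU; split=> [/andP []|[-> ->]]. Qed.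

Lemma recv_items ws C C' : #|C'| <= M -> C' \subset C :|: [set v in ws] ->
  exists l, [/\ valid X M C l, final C l = C', ios l <= size ws &
    {subset events (@as_in s G) l <= ws}].
Proof.
move=> leC' subC'.
suff [l [val fin lel inl]] : exists l, [/\ valid X M (C' :&: C) l, final (C' :&: C) l = C',
    ios l <= size ws & {subset events (@as_in s G) l <= ws}].
  (* Unwanted words are dropped before loading, so that the memory stays inside [C'] and within its
     bound. *)
  exists ((Keep, C' :&: C) :: l); split=> //=.
    split=> //; last exact: subsetIr.
    by apply: leq_trans leC'; apply/subset_leq_card/subsetIl.
have : C' :&: C \subset C' by apply: subsetIl.
have : C' \subset (C' :&: C) :|: [set v in ws].
  by apply/subsetP => v vC'; have := subsetP subC' v vC'; rewrite !inE vC'.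
move: (C' :&: C) => D; elim: ws D {C subC'} => [|w ws IH] D subD leD.
  exists [::]; split=> //; last by move=> v; rewrite inE.
  apply/eqP; rewrite eqEsubset leD /final /=; apply: subset_trans subD _.
  by apply/subsetP => v; rewrite !inE orbF.
have [|l [val fin lel inl]] := IH (C' :&: (w |: D)) _ (subsetIl _ _).
  apply/subsetP => v vC'; have := subsetP subD v vC'; rewrite !inE vC' /=.
  by case/or3P => ->; rewrite ?orbT.
exists ((In w, C' :&: (w |: D)) :: l); split=> //=.
- split=> //; last exact: subsetIr.
  by apply: leq_trans leC'; apply/subset_leq_card/subsetIl.
- by move=> v; rewrite events_cons => /setU1P [->|/inl vw]; rewrite inE ?eqxx ?vw ?orbT.
Qed.

Lemma send_items ws C C' : #|C| <= M -> #|C'| <= M -> C' \subset C -> {subset ws <= C} ->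
  exists l, [/\ valid X M C l, final C l = C', ios l <= size ws,
    events (@as_in s G) l = set0 & forall K, silent K l -> {in ws, forall v, v \notin K}].
Proof.
move=> leC leC' subC'; elim: ws => [|w ws IH] subws.
  exists [:: (Keep, C')]; split=> //=.
have [v vws|l [val fin lel inl sl]] := IH; first by apply: subws; rewrite inE vws orbT.
exists ((Out w, C) :: l); split=> //=.
- by split=> //; split=> //; apply: subws; rewrite mem_head.

- by move: lel; rewrite /ios /=; lia.
- by move=> K [wK /sl slK] v; rewrite inE => /orP [/eqP ->|/slK].
Qed.

End Items.

(** * From schedules to traces *)

Section Models.

Variables (s n : nat) (H : hybrid s n) (M : nat).
Let X := ins (top H).
Let G := prog H.

Lemma card_loaded (mem : nat -> option G) a len : #|loaded mem a len| <= len.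
Proof.
rewrite -[X in _ <= X]card_ord -(card_imset (f := @Some G) _ (@Some_inj _)).
apply: leq_trans (leq_imset_card (fun i : 'I_len => mem (a + i)) predT).
apply/subset_leq_card/subsetP => x /imsetP [v]; rewrite inE => /existsP [i /eqP e] ->.
by rewrite -e imset_f.
Qed.

(** An operation on at most [B] words becomes at most [B] transfers, and a last [Keep] empties the
    cache. The clause on [K] follows from the invariant that the slow memory contains no word of
    [K]. *)
Lemma seq_trace B acts st : execution (@seq_step s n H M B) acts st -> #|cache st| <= M ->
  exists l, [/\ valid X M (cache st) l, final (cache st) l = set0,
    ios l <= B * io_count acts,
    forall v i, onth acts i = Some (SCompute v) -> v \in events (@as_comp s G) l
  & forall K : {set G}, (forall a v, slow st a = Some v -> v \notin K) -> silent K l ->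
      unread K l].
Proof.
elim: acts st => [|act acts IH] st /=.
  move=> _ le1; exists [:: (Keep, set0)]; split=> //=.
  - by rewrite cards0 sub0set.
  - by move=> v [].
  - by move=> K _ _; rewrite /unread events_cons /= set0U; apply/pred0P => v; rewrite /= !inE.
case=> st' [le' stp] /IH /(_ le') [l' [val' fin' io' comp' prov']] le1.
have glue l1 : valid X M (cache st) l1 -> final (cache st) l1 = cache st' ->
    ios l1 <= B * is_io act ->
    (forall v, act = SCompute v -> v \in events (@as_comp s G) l1) ->
    (forall K : {set G}, (forall a v, slow st a = Some v -> v \notin K) -> silent K l1 ->
      unread K l1 /\ (forall a v, slow st' a = Some v -> v \notin K)) ->
    exists l, [/\ valid X M (cache st) l, final (cache st) l = set0,
      ios l <= B * io_count (act :: acts),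
      forall v i, onth (act :: acts) i = Some (SCompute v) -> v \in events (@as_comp s G) l
    & forall K : {set G}, (forall a v, slow st a = Some v -> v \notin K) -> silent K l ->
        unread K l].
  move=> val1 fin1 io1 comp1 prov1; exists (l1 ++ l'); split.
  - by apply/valid_cat; rewrite fin1.
  - by rewrite final_cat fin1.
  - by rewrite ios_cat /io_count /= mulnDr leq_add.
  - move=> v [|i] /=; rewrite events_cat inE.
      by case=> /comp1 ->.
    by move=> /comp' ->; rewrite orbT.
  - move=> K freeK sl; have [un1 freeK'] := prov1 K freeK (silent_catl sl).
    by apply/unread_cat; split=> //; apply: prov' freeK' (silent_catr sl un1).
case: act stp glue => [v|a len|a w] /= stp glue.
- case: stp => vX opv sub eqs; apply: (glue [:: (Comp v, cache st')]) => //=.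
  + by move=> u [<-]; rewrite events_cons /= !inE eqxx.
  + move=> K freeK _; rewrite eqs; split=> //.
    by rewrite /unread events_cons /= set0U; apply/pred0P => u; rewrite /= !inE.
- case: stp => leB sub eqs.
  have [|l1 [val1 fin1 io1 in1]] := @recv_items _ _ X M (enum (loaded (slow st) a len)) (cache st) _ le'.
    by apply: subset_trans sub _; apply/setUS/subsetP => v; rewrite inE mem_enum.
  apply: (glue l1) => //.
  + apply: leq_trans io1 _; rewrite -cardE muln1.
    exact: leq_trans (card_loaded _ _ _) leB.
  + move=> K freeK _; rewrite eqs; split=> //.
    apply/pred0P => v /=; apply/negP => /andP [/in1 vl vK].
    move: vl; rewrite mem_enum inE => /existsP [i /eqP /freeK].
    by rewrite vK.
- case: stp => leB subw sub eqs.
  have [l1 [val1 fin1 io1 in1 sl1]] := @send_items _ _ X M w _ _ le1 le' sub subw.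
  apply: (glue l1) => //; first by apply: leq_trans io1 _; rewrite muln1.
  move=> K freeK /sl1 wK; split.
    by rewrite /unread in1; apply/pred0P => u; rewrite /= !inE.
  move=> b v; rewrite eqs /store; case: ifP => // _ ev; last exact: freeK ev.
  by apply: wK; elim: (w) (b - a) ev => [|u w' IHw] [|i] //= => [[->]|/IHw];
    rewrite inE ?eqxx // => ->; rewrite orbT.
Qed.

(** The messages in transit take the place of the slow memory: as long as none contains a word of
    [K], no word of [K] can be received. *)
Lemma par_trace P Bm acts st : execution (@par_step s n H P M Bm) acts st ->
  (forall p, #|loc st p| <= M) -> (forall m, m \in net st -> #|m.2| <= Bm) ->
  exists L : 'I_P -> seq (item G), [/\
    forall p, valid X M (loc st p) (L p) /\ final (loc st p) (L p) = set0,
    forall p, ios (L p) <= Bm * messages acts p,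
    forall p v i, onth acts i = Some (PCompute p v) -> v \in events (@as_comp s G) (L p)
  & forall K : {set G}, (forall m, m \in net st -> [disjoint m.2 & K]) ->
      (forall p, silent K (L p)) -> forall p, unread K (L p)].
Proof.
elim: acts st => [|act acts IH] st /=.
  move=> _ le1 _; exists (fun _ => [:: (Keep, set0)]); split=> //=.
  - by move=> p; rewrite cards0 sub0set.
  - by move=> p v [].
  - by move=> K _ _ p; rewrite /unread events_cons /= set0U; apply/pred0P => v; rewrite /= !inE.
case=> st' [le' stp] /IH /(_ le') {}IH le1 leN.
have glue p0 l1 : only_changes p0 st st' -> valid X M (loc st p0) l1 ->
    final (loc st p0) l1 = loc st' p0 ->
    ios l1 <= Bm * messages [:: act] p0 ->
    (forall p v, act = PCompute p v -> p = p0 /\ v \in events (@as_comp s G) l1) ->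
    (forall m, m \in net st' -> #|m.2| <= Bm) ->
    (forall K : {set G}, (forall m, m \in net st -> [disjoint m.2 & K]) -> silent K l1 ->
      unread K l1 /\ (forall m, m \in net st' -> [disjoint m.2 & K])) ->
    exists L : 'I_P -> seq (item G), [/\
      forall p, valid X M (loc st p) (L p) /\ final (loc st p) (L p) = set0,
      forall p, ios (L p) <= Bm * messages (act :: acts) p,
      forall p v i, onth (act :: acts) i = Some (PCompute p v) ->
        v \in events (@as_comp s G) (L p)
    & forall K : {set G}, (forall m, m \in net st -> [disjoint m.2 & K]) ->
        (forall p, silent K (L p)) -> forall p, unread K (L p)].
  move=> only val1 fin1 io1 comp1 /IH [L' [val' io' comp' prov']] prov1.
  have messE p : messages (act :: acts) p = messages [:: act] p + messages acts p.
    by rewrite /messages /= addn0.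
  exists (fun p => (if p == p0 then l1 else [::]) ++ L' p); split.
  - move=> p; have [val2 fin2] := val' p; case: eqP => [->|/eqP np] /=; last by rewrite -only.
    rewrite final_cat fin1; have [val3 fin3] := val' p0; split=> //.
    by apply/valid_cat; rewrite fin1.
  - move=> p; rewrite messE mulnDr ios_cat leq_add //.
    by case: eqP => [->|].
  - move=> p v [|i] /=; rewrite events_cat in_setU.
      by case=> /comp1 [-> vl]; rewrite eqxx vl.
    by move=> /comp' ->; rewrite orbT.
  - move=> K freeK sl.
    have sl1 : silent K l1 by have := silent_catl (sl p0); rewrite eqxx.
    have [un1 freeK'] := prov1 K freeK sl1.
    have un0 p : unread K (if p == p0 then l1 else [::]).
      by case: eqP => // _; apply/pred0P => v; rewrite /= !inE.
    have un' := prov' K freeK' (fun p => silent_catr (sl p) (un0 p)).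
    by move=> p; apply/unread_cat.
case: act stp glue => [p v|p q w|p q w] /= [only stp] glue.
- case: stp => vX opv sub eqn; apply: (glue p [:: (Comp v, loc st' p)]) => //=.
  + by move=> p' u [<- <-]; rewrite events_cons /= !inE eqxx.
  + by rewrite eqn.
  + move=> K freeK _; rewrite eqn; split=> //.
    by rewrite /unread events_cons /= set0U; apply/pred0P => u; rewrite /= !inE.
- case: stp => npq lew subw sub eqn.
  have [|l1 [val1 fin1 io1 in1 sl1]] :=
    @send_items _ _ X M (enum w) (loc st p) _ (le1 p) (le' p) sub.
    by move=> v; rewrite mem_enum; apply: (subsetP subw).
  apply: (glue p l1) => //.
  + by apply: leq_trans io1 _; rewrite -cardE /messages /= eqxx muln1.
  + by move=> m; rewrite eqn inE => /orP [/eqP ->|/leN].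
  + move=> K freeK /sl1 wK; split.
      by rewrite /unread in1; apply/pred0P => u; rewrite /= !inE.
    move=> m; rewrite eqn inE => /orP [/eqP -> /=|/freeK //].
    by apply/pred0P => v /=; apply/negP => /andP [vw]; apply/negP/wK; rewrite mem_enum.
- case: stp => inw sub eqn.
  have [|l1 [val1 fin1 io1 in1]] := @recv_items _ _ X M (enum w) (loc st q) _ (le' q).
    by apply: subset_trans sub _; apply/setUS/subsetP => v; rewrite inE mem_enum.
  apply: (glue q l1) => //.
  + apply: leq_trans io1 _; rewrite -cardE /messages /= eqxx muln1.
    exact: (leN _ inw).
  + by move=> m; rewrite eqn => /mem_rem /leN.
  + move=> K freeK _; split; last by move=> m; rewrite eqn => /mem_rem /freeK.
    apply/pred0P => v /=; apply/negP => /andP [/in1]; rewrite mem_enum => vw vK.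
    by have /pred0P /(_ v) /= := freeK _ inw; rewrite vw vK.
Qed.

Lemma family_bound P (L : 'I_P -> seq (item G)) (C0 : 'I_P -> {set G}) :
  1 < s -> 0 < M ->
  (forall p, valid X M (C0 p) (L p)) -> (forall p, C0 p \subset X) ->
  (forall p, #|C0 p| <= M) -> (forall p, final (C0 p) (L p) = set0) ->
  (forall v, v \notin X -> exists p, v \in events (@as_comp s G) (L p)) ->
  (forall K : {set G}, [disjoint X & K] -> (forall p, silent K (L p)) ->
    forall p, unread K (L p)) ->
  nu H (8 * M) * M <= \sum_p ios (L p) /\
  \sum_(p <- subproblems (plan H) | msp1 (8 * M) p) tag p ^ 2 <= 16 * M * \sum_p ios (L p).
Proof.
move=> s1 M0 val C0X C0M fin cov prov.
have imp := top_implements H; have [okS _] := implements_ok imp.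
have [I [N [KA [KB dec]]]] := @decompose _ _ _ _ _ _ (8 * M) s1 (plan_admissible H) imp.
have each p : exists c, flatten c = L p /\ exists c0 cs,
    [/\ c = c0 :: cs, ios c0 < M & forall c', List.In c' cs -> ios c' = M].
  have [l0 [cs [e lt0 full]]] := split_chunks (L p) M0.
  by exists (l0 :: cs); split=> //; exists l0, cs.
have [ch chP] := fin_all_exists each.
have chE p := (chP p).1; have chS p := (chP p).2.
split.
- rewrite /nu -sum1_count (dec_sum dec (fun _ _ => 1)) sum1_card.
  exact: (total_outputs s1 M0 okS dec val C0X C0M cov chE chS).
- have -> : \sum_(p <- subproblems (plan H) | msp1 (8 * M) p) tag p ^ 2 =
      \sum_(i | nstd (N i)) nsize (N i) ^ 2.
    rewrite [RHS]big_mkcond -(dec_sum dec (fun m b => if b then m ^ 2 else 0)).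
    by rewrite -big_mkcondr; apply: eq_bigl => p; case: msp1; rewrite ?orbT ?andbF.
  exact: (total_products s1 M0 okS dec val C0X C0M cov prov chE fin chS).
Qed.

Lemma mem_size_gt0 (T : eqType) (x : T) (w : seq T) : x \in w -> 0 < size w.
Proof. by case: w. Qed.

Lemma numval_eq (f g : G -> 'Z_s) (w : seq G) :
  {in w, f =1 g} -> numval f w = numval g w.
Proof.
elim: w => //= v w IH eqw; rewrite eqw ?mem_head // IH // => u uw.
by apply: eqw; rewrite inE uw orbT.
Qed.

(* Otherwise the product would not depend on the digit [v]. *)
Lemma input_used v : 1 < s -> v \in X -> exists2 u, u \notin X & edge v u.
Proof.
move=> s1 vX; have [okS mulS] := implements_ok (top_implements H).
have uS := site_in_uniq okS.
have [u /andP [uX vu]|none] := pickP (fun u => (u \notin X) && edge v u).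
  by exists u.
exfalso; have noedge u : ~~ edge v u.
  have [uX|uX] := boolP (u \in X); first exact: top_inputs.
  by have := none u; rewrite /= uX /= => ->.
have n0 : 0 < n.
  case/ins_cases: vX => [vA|vB]; first by have := mem_size_gt0 vA; rewrite size_tuple.
  by have := mem_size_gt0 vB; rewrite size_tuple.
have lt1 : 1 < s ^ n by rewrite -(expn0 s) ltn_exp2l.
have lt0 : 0 < s ^ n by exact: ltnW.
(* As [v] has no outgoing edge, setting it to 1 changes no other vertex and in particular no output
   digit. *)
have contra (f : G -> 'Z_s) : run_values X f ->
    let g := eval X (fun w => if w == v then 1%R else f w) in
    numval f (inA (top H)) * numval f (inB (top H)) <>
    numval g (inA (top H)) * numval g (inB (top H)) -> False.
  move=> rf g; rewrite -(mulS f rf) -(mulS g (@eval_run _ _ _ _)); apply.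
  apply: numval_eq => w wC.
  apply: (supported_eq (X := X) (D := X :\ v) (T := [set~ v])) => //.
  - exact: eval_run.
  - move=> x; rewrite in_setC1 => xv; have [xX|xX] := boolP (x \in X).
      by left; apply/setD1P.
    right; split=> // u ux; rewrite in_setC1; apply/eqP => euv.
    by have := noedge x; rewrite -euv ux.
  - by move=> x /setD1P [xv xX]; rewrite /g eval_in // (negbTE xv).
  - rewrite in_setC1; apply/eqP => ewv; have := site_out_body okS wC.
    by rewrite ewv => vb; have := body_notin_ins okS vb; rewrite -/X vX.
have posg (f : G -> 'Z_s) (w : seq G) : v \in w -> f v = 1%R -> numval f w <> 0.
  move=> vw fv e; have := numval_digit f s1 v (_ : index v w < size w).
  by rewrite index_mem nth_index // e div0n mod0n fv => /(_ vw).
have [vA|vB] := ins_cases vX.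
- apply: (contra (input_run (top H) 0 1)); first exact: input_run_run.
  set g := eval _ _; rewrite numval_input_A // mul0n.
  have -> : numval g (inB (top H)) = 1.
    rewrite -[RHS](numval_input_B s1 uS 0 lt1); apply: numval_eq => w wB.
    rewrite /g eval_in ?in_insB //; case: eqP => // ewv.
    by move: uS; rewrite cat_uniq => /and3P [_ /hasPn /(_ w wB)]; rewrite /= ewv vA.
  rewrite muln1; apply: nesym; apply: posg vA _.
  by rewrite /g eval_in // eqxx.
- apply: (contra (input_run (top H) 1 0)); first exact: input_run_run.
  set g := eval _ _; rewrite numval_input_B // muln0.
  have -> : numval g (inA (top H)) = 1.
    rewrite -[RHS](numval_input_A s1 uS 0 lt1); apply: numval_eq => w wA.
    rewrite /g eval_in ?in_insA //; case: eqP => // ewv.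
    by move: uS; rewrite cat_uniq => /and3P [_ /hasPn /(_ v vB)]; rewrite /= -ewv wA.
  rewrite mul1n; apply: nesym; apply: posg vB _.
  by rewrite /g eval_in // eqxx.
Qed.

(** Every input digit is an operand of some operation, and the memory is empty at first, so each of
    the 2n digits has to be loaded. *)
Lemma reads_bound (l : seq (item G)) : 1 < s -> valid X M set0 l ->
  (forall v, v \notin X -> v \in events (@as_comp s G) l) -> 2 * n <= ios l.
Proof.
move=> s1 val cov; have [sup _ opT] := valid_supported val.
have [okS _] := implements_ok (top_implements H).
have -> : 2 * n = #|X|.
  by rewrite cardsE (card_uniqP (site_in_uniq okS)) size_cat !size_tuple mul2n addnn.
apply: leq_trans (leq_trans (card_events _ _) (leq_addr _ _)).
apply/subset_leq_card/subsetP => v vX; have [u uX vu] := input_used s1 vX.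
have := sup v (opT v u (cov u uX) vu); rewrite set0U => -[//|[]].
by rewrite vX.
Qed.

End Models.

Lemma type1_products_le s n (H : hybrid s n) M q : 0 < M ->
  \sum_(p <- subproblems (plan H) | msp1 (8 * M) p) tag p ^ 2 <= 16 * M * q ->
  (type1_products H (8 * M) / (4 * M)%:R <= q%:R :> rat)%R.
Proof.
move=> M0 le; rewrite /type1_products ler_pdivrMr ?ltr0n ?muln_gt0 //.
rewrite ler_pdivrMr ?ltr0n // -!natrM ler_nat; apply: leq_trans le _.
by rewrite (_ : q * (4 * M) * 4 = 16 * M * q); lia.
Qed.

Local Open Scope ring_scope.

Theorem theorem1 (s n M : nat) (H : hybrid s n)
  (hs : (1 < s)%N) (hM : (0 < M)%N) :
  (forall (B : nat) (acts : seq (seq_action (prog H))),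
     (0 < B <= M)%N -> seq_schedule H M B acts ->
     Num.max (Num.max (2 * n)%N%:R (type1_products H (8 * M)%N / (4 * M)%N%:R))
             (nu H (8 * M) * M)%N%:R / B%:R
       <= (io_count acts)%:R :> rat)
  /\
  (forall (P Bm : nat) (acts : seq (par_action (prog H) P)),
     (0 < P)%N -> (M < n)%N -> (0 < Bm <= M)%N -> par_execution H P M Bm acts ->
     exists p : 'I_P,
       Num.max (type1_products H (8 * M)%N / (4 * M)%N%:R) (nu H (8 * M) * M)%N%:R
         / (P * Bm)%N%:R
       <= (messages acts p)%:R :> rat).
Proof.
split.
- move=> B acts /andP [B0 _] [mem0 [memX _ exe cov]].
  have [|l [val fin lel comp prov]] := seq_trace exe; first by rewrite /= cards0.
  have covl v : v \notin ins (top H) -> v \in events (@as_comp s (prog H)) l.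
    by move=> /cov [i /comp].
  (* The sequential machine is treated as a single processor with empty initial memory. *)
  have [] := @family_bound _ _ H M 1 (fun _ => l) (fun _ => set0) hs hM; rewrite ?cards0 //.
  + by move=> _; exact: sub0set.
  + by move=> v /covl; exists ord0.
  + move=> K dX sl p; apply: prov (sl p) => a v /= /memX vX.
    by apply/negP => vK; have /pred0P /(_ v) := dX; rewrite /= vX vK.
  rewrite big_ord1 => le_nu le_T.
  have le_n := reads_bound hs val covl.
  rewrite ler_pdivrMr ?ltr0n // -natrM [(io_count _ * _)%N]mulnC.
  have {}lel : ((ios l)%:R <= (B * io_count acts)%:R :> rat) by rewrite ler_nat.
  apply: le_trans lel; rewrite !ge_max !ler_nat le_n le_nu andbT /=.
  exact: type1_products_le.
- move=> P Bm acts P0 _ /andP [B0 _] [loc0 [locP inP exe cov]].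
  have [||L [valfin lel comp prov]] := par_trace exe => //.
    by move=> p; have [] := locP p.
  have [] := @family_bound _ _ H M P L loc0 hs hM.
  + by move=> p; have [] := valfin p.
  + by move=> p; have [] := locP p.
  + by move=> p; have [] := locP p.
  + by move=> p; have [] := valfin p.
  + by move=> v /cov [i [p /comp]]; exists p.
  + by move=> K _ sl p; exact: prov.
  set q := (\sum_p _)%N => le_nu le_T.
  (* The busiest processor carries at least the average number of messages. *)
  pose p := [arg max_(p > Ordinal P0) messages acts p]; exists p.
  have maxp p' : (messages acts p' <= messages acts p)%N.
    by rewrite /p; case: arg_maxnP => // p1 _; exact.
  have leq_q : (q <= P * Bm * messages acts p)%N.
    rewrite -mulnA -[X in (X * _)%N]card_ord -sum_nat_const; apply: leq_sum => p' _.
    by apply: leq_trans (lel p') _; rewrite leq_mul2l maxp orbT.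
  rewrite ler_pdivrMr ?ltr0n ?muln_gt0 ?P0 // -natrM [(messages _ _ * _)%N]mulnC.
  apply: (@le_trans _ _ q%:R); last by rewrite ler_nat.
  rewrite ge_max ler_nat le_nu andbT.
  exact: type1_products_le.
Qed.
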